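(* Let $N_0\ge1$, let $g:[0,1)\to\mathbb{R}$ be measurable with respect to the dyadic partition $\mathscr{P}_{N_0}$, and let $p\in(0,1)$. If $P^g(p)\ne0$, then for any sequence of integers $(k(n))$ with $0\le k(n)\le n$ and $k(n)/n\to p$, $$\varphi^g_{n,k(n)}\ \longrightarrow\ \operatorname{sign}(P^g(p))\,\frac{\mathcal{M}_p}{\|\mathcal{M}_p\|_\infty}\qquad\text{in }L^\infty([0,1])\text{ as }n\to\infty .$$ Moreover, in this case $R^g_{n,k(n)}$ is of order $\frac1n\binom{n}{k(n)}$.
   Context: Pascal-adic transformation $T$ on $X=[0,1)$ (cutting and stacking). At stage $n\ge1$ there are $n+1$ towers $\tau_{n,0},\dots,\tau_{n,n}$; $\tau_{n,k}$ is an ordered (bottom to top) list of $\binom nk$ disjoint intervals (''rungs'') of the form $[\cdot,\cdot)$ and length $2^{-n}$, and $T$ maps each rung except the top one by translation onto the rung just above it. Start: $\tau_{1,0}$ has the single rung $[0,1/2)$ and $\tau_{1,1}$ the single rung $[1/2,1)$. From stage $n$ to $n+1$: cut each tower into its left-half and right-half sub-columns, and for $0\le k\le n-1$ define $T$ on the right half of the top rung of $\tau_{n,k}$ as the translation onto the left half of the base (bottom rung) of $\tau_{n,k+1}$. Thus $\tau_{n+1,0}$ is the left half of $\tau_{n,0}$, $\tau_{n+1,n+1}$ is the right half of $\tau_{n,n}$, and for $1\le k\le n$, $\tau_{n+1,k}$ is the right half of $\tau_{n,k-1}$ with the left half of $\tau_{n,k}$ stacked on top of it. Iterating defines $T$ on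 $X$ minus a countable set. The basis of $\tau_{n,k}$ is its bottom rung. $\mathscr{P}_{N_0}$ is the partition of $[0,1)$ into the $2^{N_0}$ dyadic intervals $[i2^{-N_0},(i+1)2^{-N_0})$; a $\mathscr{P}_{N_0}$-measurable function is one constant on each of these intervals. For $g$ $\mathscr{P}_{N_0}$-measurable, $n\ge N_0$ and $0\le k\le n$, $F^g_{n,k}:[0,\binom nk]\to\mathbb{R}$ is the function with $F^g_{n,k}(\ell)=\sum_{j=0}^{\ell-1}g(T^jx)$ at integers $0\le\ell\le\binom nk$, where $x$ is any point of the basis of $\tau_{n,k}$ (the value does not depend on $x$), linearly interpolated between integers. Put $R^g_{n,k}:=\max_{0\le t\le1}|F^g_{n,k}(t\binom nk)-tF^g_{n,k}(\binom nk)|$ if this is nonzero and $R^g_{n,k}:=1$ otherwise, and $$\varphi^g_{n,k}(t):=\frac{F^g_{n,k}\bigl(t\binom nk\bigr)-tF^g_{n,k}\bigl(\binom nk\bigr)}{R^g_{n,k}},\qquad t\in[0,1].$$ Let $h^g_{N_0,\ell}:=F^g_{N_0,\ell}\bigl(\binom{N_0}{\ell}\bigr)$ for $0\le\ell\le N_0$ (the sum of the values of $g$ over the rungs of $\tau_{N_0,\ell}$), and $$P^g(p):=\sum_{\ell=0}^{N_0}h^g_{N_0,\ell}\,p^\ell(1-p)^{N_0-\ell}(N_0p-\ell).$$ For $0<p<1$, let $\alpha_p^L(x,y):=(px,\,py+x)$ and $\alpha_p^R(x,y):=\bigl((1-p)x+p,\,(1-p)y-x+1\bigr)$, affine maps of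 $[0,1]\times\mathbb{R}$ to itself. There is a unique nonempty compact set $E_p\subset[0,1]\times\mathbb{R}$ with $E_p=\alpha_p^L(E_p)\cup\alpha_p^R(E_p)$, and $E_p$ is the graph of a continuous function $\mathcal{M}_p:[0,1]\to\mathbb{R}$; this defines $\mathcal{M}_p$. ''$u_n$ is of order $v_n$'' means that there are constants $0<c\le C<\infty$ with $c\,v_n\le |u_n|\le C\,v_n$ for all sufficiently large $n$. *)

(* Defs.v *)
From HB Require Import structures.
From mathcomp Require Import all_boot all_order all_algebra.
From mathcomp Require Import all_classical all_reals all_analysis.
From mathcomp Require Import lra.

Set Implicit Arguments.
Unset Strict Implicit.
Unset Printing Implicit Defensive.

Import Order.TTheory GRing.Theory Num.Theory.
Import numFieldNormedType.Exports.

Local Open Scope classical_set_scope.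
Local Open Scope ring_scope.

Section PascalAdic.
Context {R : realType}.
Implicit Types (g : R -> R) (n k l : nat) (x t p : R).

(* A rung of stage n is represented by its left endpoint a. *)
Definition rung n (a : R) : set R := `[a, a + 2^-1 ^+ n[.

(* The towers, bottom to top, with tower n k = [::] for k > n.  The recursion
   is started one step early, at the one-rung tower [0, 1) of stage 0: its
   cutting gives the two towers of stage 1, see tower10 and tower11. *)
Fixpoint tower n k : seq R :=
  match n, k with
  | 0, 0 => [:: 0]
  | 0, _.+1 => [::]
  | n'.+1, 0 => tower n' 0
  | n'.+1, k'.+1 =>
      [seq a + 2^-1 ^+ n'.+1 | a <- tower n' k'] ++ tower n' k'.+1
  end.

Lemma tower10 : tower 1 0 = [:: 0].
Proof. by []. Qed.

Lemma tower11 : tower 1 1 = [:: 2^-1].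
Proof. by rewrite /= add0r expr1. Qed.

Lemma size_tower n k : size (tower n k) = 'C(n, k).
Proof.
elim: n k => [|n IHn] [|k] //=; first by rewrite IHn !bin0.
by rewrite size_cat size_map !IHn binS addnC.
Qed.

(* y is the image of x under the translation of some non-top rung containing x
   onto the rung just above it. *)
Definition pascal_rel x (y : R) : Prop :=
  exists n k j, [/\ (j.+1 < size (tower n k))%N,
    rung n (tower n k)`_j x
    & y = x + ((tower n k)`_j.+1 - (tower n k)`_j)].

(* The value is x itself (junk) at the points where T is never defined. *)
Definition pascal x : R := xget x [set y | pascal_rel x y].

Lemma rung_inj n k k' j j' x :
  (j < size (tower n k))%N -> (j' < size (tower n k'))%N ->
  rung n (tower n k)`_j x -> rung n (tower n k')`_j' x -> k = k' /\ j = j'.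
Proof.
have h0 m : 0 < (2^-1 : R) ^+ m by rewrite exprn_gt0 // invr_gt0 ltr0n.
have half m : (2^-1 : R) ^+ m = 2^-1 ^+ m.+1 + 2^-1 ^+ m.+1.
  by rewrite exprS; lra.
(* every rung of stage n.+1 is the left or right half of a rung of stage n *)
have split_rung m i q : (q < size (tower m.+1 i))%N ->
   (exists2 i', i = i'.+1 & (q < size (tower m i'))%N /\
      (tower m.+1 i)`_q = (tower m i')`_q + 2^-1 ^+ m.+1) \/
   (exists q', [/\ (q' < size (tower m i))%N,
      (tower m.+1 i)`_q = (tower m i)`_q'
      & q = (q' + (if i is i'.+1 then size (tower m i') else 0))%N]).
  case: i => [|i] /= hq; first by right; exists q; rewrite addn0.
  move: hq; rewrite size_cat size_map nth_cat size_map => hq'.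
  case: ltnP => hq.
    by left; exists i => //; split => //; rewrite (nth_map 0).
  right; exists (q - size (tower m i))%N; split => //.
    by rewrite ltn_subLR.
  by rewrite subnK.
elim: n k k' j j' => [|n IHn] k k' j j'.
  by case: k k' => [|k] [|k'] //=; case: j j' => [|j] [|j'].
rewrite /rung /= => hj hj'; rewrite !in_itv /=.
have := h0 n.+1; have := half n.
case: (split_rung _ _ _ hj) => [[i -> [hi ->]]|[q [hq -> ->]]];
case: (split_rung _ _ _ hj') => [[i' -> [hi' ->]]|[q' [hq' -> ->]]] e e0 /andP[a1 a2] /andP[b1 b2].
- case: (IHn i i' j j' hi hi'); rewrite ?/rung /= ?in_itv /=; [lra|lra|].
  by move=> -> ->.
- case: (IHn i k' j q' hi hq'); rewrite ?/rung /= ?in_itv /=; [lra|lra|].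
  by move=> ii qq; exfalso; move: a1 b2; rewrite ii qq; lra.
- case: (IHn k i' q j' hq hi'); rewrite ?/rung /= ?in_itv /=; [lra|lra|].
  by move=> ii qq; exfalso; move: b1 a2; rewrite ii qq; lra.
- case: (IHn k k' q q' hq hq'); rewrite ?/rung /= ?in_itv /=; [lra|lra|].
  by move=> -> ->.
Qed.

Lemma rung_refine m n k j x : (j.+1 < size (tower n k))%N ->
  rung n (tower n k)`_j x ->
  exists k' j', [/\ (j'.+1 < size (tower (m + n) k'))%N,
    rung (m + n) (tower (m + n) k')`_j' x
    & (tower (m + n) k')`_j'.+1 - (tower (m + n) k')`_j'
      = (tower n k)`_j.+1 - (tower n k)`_j].
Proof.
elim: m => [|m IHm] hj hx; first by exists k, j.
have [k' [j' [hj' hx' <-]]] := IHm hj hx.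
rewrite addSn; move: (m + n)%N hj' hx' => N {}hj {}hx.
have h0 : 0 < (2^-1 : R) ^+ N.+1 by rewrite exprn_gt0 // invr_gt0 ltr0n.
have e : (2^-1 : R) ^+ N = 2^-1 ^+ N.+1 + 2^-1 ^+ N.+1 by rewrite exprS; lra.
move: hx; rewrite /rung /= in_itv /= => /andP[x1 x2].
have [lt_x|ge_x] := ltP x ((tower N k')`_j' + 2^-1 ^+ N.+1).
  case: k' hj x1 x2 lt_x => [|k'] hj x1 x2 lt_x.
    by exists 0%N, j'; rewrite /= in_itv /= x1 lt_x.
  exists k'.+1, (size (tower N k') + j')%N.
  rewrite /= size_cat size_map -addnS ltn_add2l !nth_cat size_map.
  by rewrite !ltnNge !leq_addr /= !addKn in_itv /= x1 lt_x -ltnNge.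
exists k'.+1, j'; rewrite /= size_cat size_map !nth_cat size_map.
rewrite hj (ltnW hj) !(nth_map 0) ?hj ?(ltnW hj) //; split; last lra.
  by rewrite (leq_trans hj) ?leq_addr.
by rewrite in_itv /=; lra.
Qed.

Lemma pascalE n k j x : (j.+1 < size (tower n k))%N ->
  rung n (tower n k)`_j x ->
  pascal x = x + ((tower n k)`_j.+1 - (tower n k)`_j).
Proof.
move=> hj hx; apply: xget_subset1; first by exists n, k, j.
move=> _ _ [n1 [k1 [j1 [hj1 hx1 ->]]]] [n2 [k2 [j2 [hj2 hx2 ->]]]].
have [k1' [j1' [hj1' hx1' <-]]] := rung_refine n2 hj1 hx1.
have [k2' [j2' [hj2' hx2' <-]]] := rung_refine n1 hj2 hx2.
move: hj2' hx2'; rewrite addnC => hj2' hx2'.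
by have [-> ->] := rung_inj (ltnW hj1') (ltnW hj2') hx1' hx2'.
Qed.

(* g is constant on each interval [i 2^-N, (i + 1) 2^-N) with i < 2 ^ N;
   its values outside [0, 1) are irrelevant. *)
Definition dyadic_measurable N g : Prop :=
  forall i, (i < 2 ^ N)%N ->
  forall x y, rung N (i%:R * 2^-1 ^+ N) x -> rung N (i%:R * 2^-1 ^+ N) y ->
  g x = g y.

Definition birkhoff_sum g x l : R := \sum_(0 <= j < l) g (iter j pascal x).

Lemma tower_dyadic n k j : (j < size (tower n k))%N ->
  exists2 i, (i < 2 ^ n)%N & (tower n k)`_j = i%:R * 2^-1 ^+ n.
Proof.
have two m (i : nat) : i%:R * (2^-1 : R) ^+ m = i.*2%:R * 2^-1 ^+ m.+1.
  by rewrite exprS -muln2 natrM; lra.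
elim: n k j => [|n IHn] k j.
  by case: k j => [|k] [|j] //= _; exists 0%N; rewrite // mul0r.
case: k => [/= /IHn[i hi ->]|k /=].
  by exists i.*2; [rewrite expnS mul2n ltn_double|rewrite two].
rewrite size_cat size_map nth_cat size_map => hj; case: ltnP => hjk.
  have [i hi e] := IHn _ _ hjk.
  exists i.*2.+1; first by rewrite expnS mul2n ltn_Sdouble.
  by rewrite (nth_map 0) // e two -[i.*2.+1%:R]natr1 mulrDl mul1r.
have [|i hi ->] := IHn k.+1 (j - size (tower n k))%N; first by rewrite ltn_subLR.
by exists i.*2; [rewrite expnS mul2n ltn_double|rewrite two].
Qed.

Lemma rung_coarse N n i x : (N <= n)%N -> rung n (i%:R * 2^-1 ^+ n) x ->
  rung N ((i %/ 2 ^ (n - N))%:R * 2^-1 ^+ N) x.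
Proof.
move=> leNn; set d := (2 ^ (n - N))%N; rewrite /rung /= !in_itv /=.
have d0 : (0 < d)%N by rewrite expn_gt0.
have h0 : 0 < (2^-1 : R) ^+ n by rewrite exprn_gt0 // invr_gt0 ltr0n.
have -> : (2^-1 : R) ^+ N = d%:R * 2^-1 ^+ n.
  rewrite -[in RHS](subnK leNn) exprD mulrA natrX -exprMn.
  rewrite mulfV ?pnatr_eq0 //.
  by rewrite expr1n mul1r.
rewrite !mulrA -mulrDl -!natrM -natrD => /andP[x1 x2].
  have {}x2 : x < i.+1%:R * 2^-1 ^+ n by rewrite -natr1 mulrDl mul1r.
apply/andP; split.
  by apply: le_trans x1; rewrite ler_pM2r // ler_nat leq_divM.
apply: (lt_le_trans x2); rewrite ler_pM2r // ler_nat.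
by rewrite addnC -mulSn ltn_ceil.
Qed.

Lemma iter_pascal n k j x : (j < size (tower n k))%N ->
  rung n (tower n k)`_0 x ->
  iter j pascal x = x + ((tower n k)`_j - (tower n k)`_0)
  /\ rung n (tower n k)`_j (iter j pascal x).
Proof.
move=> hj hx; elim: j hj => [|j IHj] hj; first by rewrite subrr addr0.
have [e hr] := IHj (ltnW hj).
have -> : iter j.+1 pascal x = x + ((tower n k)`_j.+1 - (tower n k)`_0).
  by rewrite iterS (pascalE hj hr) e; lra.
by split=> //; move: hx; rewrite /rung /= !in_itv /=; lra.
Qed.

(* The point of the basis of tower n k at which the sums are computed is its
   left endpoint; birkhoff_sum_basis shows that the choice is immaterial. *)
Definition base n k : R := head 0 (tower n k).

Lemma birkhoff_sum_basis N g n k x l : dyadic_measurable N g -> (N <= n)%N ->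
  (l <= 'C(n, k))%N -> rung n (base n k) x ->
  birkhoff_sum g x l = birkhoff_sum g (base n k) l.
Proof.
rewrite /base -nth0 -size_tower => mg leNn hl hx.
rewrite /birkhoff_sum !big_nat; apply: eq_bigr => j /andP[_ hjl].
have hj := leq_trans hjl hl.
have h0 : 0 < (2^-1 : R) ^+ n by rewrite exprn_gt0 // invr_gt0 ltr0n.
have hb : rung n (tower n k)`_0 (tower n k)`_0.
  by rewrite /rung /= in_itv /= lexx ltrDl.
have [_ r1] := iter_pascal hj hx; have [_ r2] := iter_pascal hj hb.
have [i hi e] := tower_dyadic hj; rewrite e in r1 r2.
apply: (mg (i %/ 2 ^ (n - N))%N); [|exact: rung_coarse r1|exact: rung_coarse r2].
by rewrite ltn_divLR ?expn_gt0 // -expnD subnKC.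
Qed.

(* Linear interpolation; only the values at 0 <= s <= 'C(n, k) matter. *)
Definition F g n k (s : R) : R :=
  let l := Num.truncn s in
  let B := birkhoff_sum g (base n k) in
  B l + (s - l%:R) * (B l.+1 - B l).

Definition F_dev g n k t : R :=
  F g n k (t * 'C(n, k)%:R) - t * F g n k 'C(n, k)%:R.

(* F_dev is continuous in t, so that the supremum is a maximum. *)
Definition max_dev g n k : R := sup [set `|F_dev g n k t| | t in `[0, 1]].

Definition renorm g n k : R :=
  if max_dev g n k == 0 then 1 else max_dev g n k.

Definition phi g n k t : R := F_dev g n k t / renorm g n k.

Definition tower_sum g N l : R := F g N l 'C(N, l)%:R.

Definition P_poly g N p : R :=
  \sum_(0 <= l < N.+1)
    tower_sum g N l * p ^+ l * (1 - p) ^+ (N - l) * (N%:R * p - l%:R).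

Definition alphaL p (z : R * R) : R * R := (p * z.1, p * z.2 + z.1).

Definition alphaR p (z : R * R) : R * R :=
  ((1 - p) * z.1 + p, (1 - p) * z.2 - z.1 + 1).

Definition is_attractor p (E : set (R * R)) : Prop :=
  [/\ E !=set0, compact E, E `<=` `[0, 1] `*` setT
    & E = (alphaL p @` E) `|` (alphaR p @` E)].

(* For 0 < p < 1 the attractor exists, is unique, and is the graph of a
   continuous function on [0, 1]; the default values set0 and 0 are junk. *)
Definition attractor p : set (R * R) := xget set0 [set E | is_attractor p E].

Definition Mcurve p x : R := xget 0 [set y | attractor p (x, y)].

(* The norm of L^oo([0, 1]): the essential supremum of |f| over [0, 1]. *)
Definition Linfty_norm (f : R -> R) : \bar R :=
  ('N[lebesgue_measure]_+oo [EFin \o (f \_ `[0, 1])%R])%E.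

Definition of_order (u v : nat -> R) : Prop :=
  exists c C : R, [/\ 0 < c, c <= C
    & \forall n \near \oo, c * v n <= `|u n| <= C * v n].

End PascalAdic.

(* Main.v *)
Require Import Defs.
From mathcomp Require Import all_boot all_order all_algebra.
From mathcomp Require Import all_classical all_reals all_analysis.
From mathcomp Require Import ess_sup_inf ring lra zify.

Import Order.TTheory GRing.Theory Num.Theory.
Import numFieldNormedType.Exports.

Set Implicit Arguments.
Unset Strict Implicit.
Unset Printing Implicit Defensive.

Local Open Scope classical_set_scope.
Local Open Scope ring_scope.

(** Reading g along a tower, bottom to top, gives a word, and cutting and
stacking makes the word of tower [n+1, k+1] the concatenation of those of
towers [n, k] and [n, k+1] (tower_wordS).  The curve of deviations of the
partial sums of a concatenation is made of two pieces, each of which is the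
curve of one factor plus a linear function; the two linear functions form a
tent whose top is above the cutting point q = (k+1)/(n+1) and whose height is
the skew (1 - q) h(n, k) - q h(n, k+1), h denoting the totals of the words
(tower_dev_left, tower_dev_right).

The totals h(n, k) are convolutions of the totals at stage N0 with binomial
coefficients, and the algebra of these coefficients turns the skew into an
explicit sum (skewE) which, multiplied by (n+1) / C(n+1, k+1), tends to P^g(p)
when n -> oo and k/n -> p (skew_lim).  So the rescaled curves
G(n, k) = n / C(n, k) * deviation satisfy, up to a vanishing error, the same
relation as P^g(p) M_p: on [0, q] and on [q, 1] they are contracted copies, by
factors close to p and 1 - p, of curves of the previous stage, plus a tent of
height close to P^g(p) (tower_curve_left, tower_curve_right).

Two ingredients make the limit follow.  First, an a priori bound
(tower_dev_bound): the deviation is at most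
K C(n, k) (n + 1) / ((k + 1) (n - k + 1)), a quantity whose increments from
(n, k) or (n, k+1) to (n+1, k+1) dominate the skew if K is large, so that
induction on n applies to all k at once; near the ray k/n = p this bounds the
G(n, k).
Secondly, the distance from G(n, k) to P^g(p) M_p is contracted by a factor
r < 1 at each stage, up to an arbitrarily small error (tower_curve_step).
Iterating, this distance tends to 0 (tower_curve_lim).  All the limits in
(n, k) are taken along one filter, stable under the two predecessor maps
(n-1, k-1) and (n-1, k).

The curve M_p is built as the fixed point of the operator
f |-> (p f(t/p) or (1-p) f((t-p)/(1-p))) + tent, contracting on functions
that vanish off ]0, 1[ (curve_op_fixpoint), and its graph is shown to be the
only attractor (attractorE).  Since M_p is continuous and M_p(p) = 1, its
essential supremum is its maximum and is positive; uniform convergence of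
G(n, k(n)) then gives the order of the renormalization and, dividing by it,
the limit of phi. *)

(** * The curve as a fixed point *)

Section Blancmange.
Context {R : realType}.
Implicit Types (f h M : R -> R) (p q t x y : R).

Lemma unif_continuous_realP f : unif_continuous f <->
  forall e, 0 < e -> exists2 d, 0 < d &
    forall x y, `|x - y| < d -> `|f x - f y| < e.
Proof.
split=> [/unif_continuousP fc e /fc[d d0 fd]|fc].
  by exists d => // x y xy; have := fd (x, y); rewrite -!ball_normE; apply.
apply/unif_continuousP => e /fc[d d0 fd].
by exists d => // -[x y] /=; rewrite -!ball_normE; apply: fd.
Qed.

Lemma unif_continuous_real f : unif_continuous f -> continuous f.
Proof.
move=> /unif_continuous_realP fc x; apply/cvgrPdist_lt => e /fc[d d0 fd].
exists d => //= y xy; exact: fd.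
Qed.

(** The tent over [0, 1] with top at p is bump (t / p) ((1 - t) / (1 - p)). *)
Definition bump x y : R := Num.max 0 (Num.min x y).

Lemma bump_lip x y x' y' : `|bump x y - bump x' y'| <= `|x - x'| + `|y - y'|.
Proof.
have := ler_norm (x - x'); have := ler_norm (y - y').
have := ler_norm (x' - x); have := ler_norm (y' - y).
rewrite (distrC x') (distrC y') /bump ler_norml.
have [|] := leP x y; have [|] := leP x' y';
repeat (match goal with |- context [Order.max ?a ?b] => have [|] := leP a b
  end);
lra.
Qed.

(** For f vanishing off ]0, 1[ at most one of the two copies of f is nonzero at
t, so that this single formula, without case distinction at t = p, expresses
that the graph of the image is the union of the images of the graph of f
under the two affine maps; see curve_op_left and curve_op_right.  It depends
continuously on t and on p. *)
Definition curve_op p f t : R :=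
  p * f (t / p) + (1 - p) * f (1 - (1 - t) / (1 - p))
  + bump (t / p) ((1 - t) / (1 - p)).

Definition supp01 f := forall x, ~~ (0 < x < 1) -> f x = 0.

(** The common source of the uniform continuity of the image (case p = q) and
of its continuous dependence on p (case x = y). *)
Lemma curve_op_close f d e p q x y : 0 < p < 1 -> 0 < q < 1 ->
  (forall x y, `|x - y| < d -> `|f x - f y| < e) ->
  `|x / p - y / q| < d ->
  `|(1 - x) / (1 - p) - (1 - y) / (1 - q)| < d ->
  `|curve_op p f x - curve_op q f y| <= e + 2 * d
    + `|p - q| * (`|f (x / p)| + `|f (1 - (1 - x) / (1 - p))|).
Proof.
move=> /andP[p0 p1] /andP[q0 q1] fde hu hv; rewrite /curve_op.
have q0' : 0 < 1 - q by lra.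
have := bump_lip (x / p) ((1 - x) / (1 - p)) (y / q) ((1 - y) / (1 - q)).
set u := x / p in hu *; set u' := y / q in hu *.
set v := (1 - x) / (1 - p) in hv *; set v' := (1 - y) / (1 - q) in hv *.
have fu := fde _ _ hu.
have hv' : `|(1 - v) - (1 - v')| < d.
  by rewrite distrC (_ : _ - _ = v - v') //; lra.
have fv := fde _ _ hv'.
set b := bump u v; set b' := bump u' v' => hb.
have -> : p * f u + (1 - p) * f (1 - v) + b
  - (q * f u' + (1 - q) * f (1 - v') + b')
  = q * (f u - f u') + (1 - q) * (f (1 - v) - f (1 - v'))
  + (b - b') + ((p - q) * f u - (p - q) * f (1 - v)) by ring.
apply: (le_trans (ler_normD _ _)).
rewrite [X in _ <= _ + X]mulrDr; apply: lerD; last first.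
  by apply: (le_trans (ler_normB _ _)); rewrite !normrM.
apply: (le_trans (ler_normD _ _)); apply: lerD; last lra.
apply: (le_trans (ler_normD _ _));
  rewrite !normrM (gtr0_norm q0) (gtr0_norm q0').
have : q * `|f u - f u'| <= q * e by rewrite ler_pM2l // ltW.
have : (1 - q) * `|f (1 - v) - f (1 - v')| <= (1 - q) * e.
  by rewrite ler_pM2l ?subr_gt0 // ltW.
lra.
Qed.

Lemma curve_op_unif p f : 0 < p < 1 -> unif_continuous f ->
  unif_continuous (curve_op p f).
Proof.
move=> p01 /unif_continuous_realP fc; apply/unif_continuous_realP => e e0.
have e4 : 0 < e / 4 by lra.
have [d1 d10 fd] := fc _ e4.
have /andP[p0 p1] := p01; pose d := Num.min d1 (e / 4).
have d0 : 0 < d by rewrite lt_min d10.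
have dd1 : d <= d1 by rewrite ge_min lexx.
have de : d <= e / 4 by rewrite ge_min lexx orbT.
have q0 : 0 < 1 - p by lra.
exists (d * (p * (1 - p))); first by rewrite !mulr_gt0.
move=> x y xy.
have hd c : c <= 1 -> 0 < c -> p * (1 - p) <= c -> `|x - y| / c < d.
  move=> c1 c0 cp; rewrite ltr_pdivrMr //; apply: lt_le_trans xy _.
  by rewrite ler_pM2l.
apply: le_lt_trans (_ : e / 4 + 2 * d < e); last lra.
have : `|p - p| = 0 by rewrite subrr normr0.
move=> pp; have := @curve_op_close f d (e/4) p p x y p01 p01.
rewrite pp mul0r addr0; apply.
- by move=> a b ab; apply: fd; apply: lt_le_trans dd1.
- rewrite -mulrBl normrM normfV (gtr0_norm p0); apply: hd => //; first lra.
  by rewrite ger_pMr//; lra.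
- rewrite -mulrBl normrM normfV (gtr0_norm q0).
  rewrite (_ : 1 - x - (1 - y) = y - x); last by ring.
  by rewrite distrC; apply: hd => //; [lra|rewrite ger_pMl//; lra].
Qed.

(** The approximate curves are cut at k/n rather than at p: this controls the
error made by cutting the limit curve at the wrong place. *)
Lemma curve_op_param p f : 0 < p < 1 -> unif_continuous f ->
  (exists B, forall x, `|f x| <= B) ->
  forall e, 0 < e -> \forall q \near p, forall t, 0 <= t <= 1 ->
    `|curve_op q f t - curve_op p f t| <= e.
Proof.
move=> p01 /unif_continuous_realP fc [B fB] e e0.
have e4 : 0 < e / 4 by lra.
have [d1 d10 fd] := fc _ e4.
have /andP[p0 p1] := p01; pose d := Num.min d1 (e / 4).
have d0 : 0 < d by rewrite lt_min d10.
have dd1 : d <= d1 by rewrite ge_min lexx.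
have de : d <= e / 4 by rewrite ge_min lexx orbT.
have q0 : 0 < 1 - p by lra.
have B0 : 0 <= B by apply: le_trans (fB 0).
have c1 : (fun q : R => q^-1) q @[q --> p] --> p^-1.
  by apply: inv_continuous; rewrite gt_eqF.
have c2 : (fun q : R => (1 - q)^-1) q @[q --> p] --> (1 - p)^-1.
  apply: cvgV; first by rewrite gt_eqF.
  by apply: cvgB; [exact: cvg_cst|exact: cvg_id].
have c3 : `|q - p| * (2 * B) @[q --> p] --> 0.
  rewrite [X in _ --> X](_ : 0 = `|p - p| * (2 * B));
    last by rewrite subrr normr0 mul0r.
  by apply: cvgM (cvg_cst _); apply: cvg_norm; apply: cvgB (cvg_cst _);
    exact: cvg_id.
have pid : q @[q --> p] --> p by exact: cvg_id.
near=> q => t /andP[t0 t1].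
have q01 : 0 < q < 1.
  apply/andP; split; near: q.
    exact: (cvgr_gt p).
  exact: (cvgr_lt p).
have /ltW k3 : `|q - p| * (2 * B) < e / 4.
  near: q; exact: (cvgr_lt 0).
have kd a (r : R) : 0 <= a <= 1 -> `|r| < d -> `|a * r| < d.
  move=> /andP[a0 a1]; apply: le_lt_trans.
  by rewrite normrM ger0_norm // ler_piMl.
apply: le_trans (curve_op_close q01 p01 (d := d) (e := e / 4) _ _ _) _.
- by move=> a b ab; apply: fd; apply: lt_le_trans dd1.
- rewrite -mulrBr; apply: kd; first by rewrite t0.
  by rewrite distrC; near: q; move/cvgrPdist_lt: c1; apply.
- rewrite -mulrBr; apply: kd; first by lra.
  by rewrite distrC; near: q; move/cvgrPdist_lt: c2; apply.
- have := fB (t / q); have := fB (1 - (1 - t) / (1 - q)).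
  move: k3; set a := `|f _|; set b := `|f _|; set c := `|q - p| => k3 h1 h2.
  have : c * (b + a) <= c * (2 * B) by apply: ler_wpM2l; [exact: normr_ge0|lra].
  lra.
Unshelve. all: by end_near.
Qed.

Lemma curve_op_left p f t : 0 < p < 1 -> supp01 f -> 0 <= t <= p ->
  curve_op p f t = p * f (t / p) + t / p.
Proof.
move=> /andP[p0 p1] fs /andP[t0 tp]; have q0 : 0 < 1 - p by lra.
have h1 : t / p <= 1 by rewrite ler_pdivrMr // mul1r.
have h0 : 0 <= t / p by rewrite divr_ge0 // ltW.
have h2 : 1 <= (1 - t) / (1 - p) by rewrite ler_pdivlMr // mul1r; lra.
rewrite /curve_op [f (1 - _)]fs; last by rewrite negb_and -leNgt; apply/orP;
  left; lra.
rewrite mulr0 addr0 /bump min_l; last exact: le_trans h2.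
by rewrite max_r.
Qed.

Lemma curve_op_right p f t : 0 < p < 1 -> supp01 f -> p <= t <= 1 ->
  curve_op p f t = (1 - p) * f (1 - (1 - t) / (1 - p)) + (1 - t) / (1 - p).
Proof.
move=> /andP[p0 p1] fs /andP[t0 tp]; have q0 : 0 < 1 - p by lra.
have h1 : 1 <= t / p by rewrite ler_pdivlMr // mul1r.
have h0 : 0 <= (1 - t) / (1 - p) by apply: divr_ge0; lra.
have h2 : (1 - t) / (1 - p) <= 1 by rewrite ler_pdivrMr // mul1r; lra.
rewrite /curve_op [f (t / p)]fs; last by rewrite negb_and -!leNgt h1 orbT.
rewrite mulr0 add0r /bump min_r; last exact: le_trans h1.
by rewrite max_r.
Qed.

Lemma curve_op_supp p f : 0 < p < 1 -> supp01 f -> supp01 (curve_op p f).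
Proof.
move=> /andP[p0 p1] fs x; rewrite negb_and -!leNgt => hx.
have q0 : 0 < 1 - p by lra.
rewrite /curve_op !fs ?mulr0 ?add0r; first last.
- rewrite negb_and -!leNgt; case/orP: hx => hx; apply/orP; [left|right].
    by rewrite ler_pdivrMr // mul0r.
  by rewrite ler_pdivlMr // mul1r; lra.
- rewrite negb_and -!leNgt; case/orP: hx => hx; apply/orP; [left|right].
    have : 1 <= (1 - x) / (1 - p) by rewrite ler_pdivlMr // mul1r; lra.
    lra.
  have : (1 - x) / (1 - p) <= 0 by rewrite ler_pdivrMr // mul0r; lra.
  lra.
rewrite /bump max_l // ge_min; case/orP: hx => hx; apply/orP; [left|right].
  by rewrite ler_pdivrMr // mul0r.
by rewrite ler_pdivrMr // mul0r; lra.
Qed.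

(** On each side of p only one copy of f and h is seen, scaled by p or 1 - p. *)
Lemma curve_op_contract p r c f h : 0 < p < 1 -> p <= r -> 1 - p <= r ->
  supp01 f -> supp01 h -> (forall t, `|f t - h t| <= c) ->
  forall t, `|curve_op p f t - curve_op p h t| <= r * c.
Proof.
move=> p01 pr qr fs hs fh t; have /andP[p0 p1] := p01.
have c0 : 0 <= c by apply: le_trans (fh 0).
have [t01|t01] := boolP (0 < t < 1); last first.
  by rewrite !(curve_op_supp p01 _ t01) // subrr normr0 mulr_ge0 //; lra.
case/andP: t01 => t0 t1.
have key a x : 0 < a -> a <= r -> `|a * (f x - h x)| <= r * c.
  by move=> a0 ar; rewrite normrM gtr0_norm // ler_pM // ltW.
have [tp|tp] := leP t p.
  rewrite !curve_op_left ?(ltW t0) // (_ : _ - _ = p * (f (t / p) - h (t / p))).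
    exact: key.
  by ring.
rewrite !curve_op_right ?(ltW tp) ?(ltW t1) //.
set z := 1 - _ / _; set w := _ / _.
rewrite (_ : _ - _ = (1 - p) * (f z - h z)); last by ring.
by apply: key; rewrite ?subr_gt0.
Qed.

(** u n - c n is nondecreasing and u n + c n nonincreasing for
c n = r ^ n / (1 - r), so the supremum of the former lies between the two. *)
Lemma geometric_cauchy_lim (u : nat -> R) (r : R) : 0 < r < 1 ->
  (forall n, `|u n.+1 - u n| <= r ^+ n) ->
  exists l, forall n, `|l - u n| <= r ^+ n / (1 - r).
Proof.
move=> /andP[r0 r1] ur; have r1' : 0 < 1 - r by lra.
pose c n := r ^+ n / (1 - r).
have cS n : c n = c n.+1 + r ^+ n.
  by rewrite /c exprS; field; rewrite gt_eqF.
have c0 n : 0 < c n by rewrite divr_gt0 // exprn_gt0.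
have vi n m : u n - c n <= u (m + n)%N - c (m + n)%N.
  elim: m => [|m IH] //; apply: (le_trans IH); rewrite addSn.
  have := cS (m + n)%N; have := ur (m + n)%N;
    rewrite ler_norml => /andP[? _]; lra.
have wi n m : u (m + n)%N + c (m + n)%N <= u n + c n.
  elim: m => [|m IH] //; apply: le_trans IH; rewrite addSn.
  have := cS (m + n)%N; have := ur (m + n)%N;
    rewrite ler_norml => /andP[_ ?]; lra.
have vw n m : u n - c n <= u m + c m.
  have := vi n m; have := wi m n; rewrite (addnC n m); have := c0 (m + n)%N;
    lra.
pose E := range (fun n => u n - c n).
have Eub m : ubound E (u m + c m) by move=> _ [n _ <-].
exists (sup E) => n; rewrite -/(c n).
have h1 : u n - c n <= sup E by apply: ub_le_sup;
  [exists (u 0%N + c 0%N)|exists n].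
have h2 : sup E <= u n + c n.
  by apply: ge_sup; [exists (u 0%N - c 0%N); exists 0%N|exact: Eub].
by rewrite ler_norml; apply/andP; split; lra.
Qed.

Lemma expr_lt_eps (r e : R) : 0 < r < 1 -> 0 < e -> exists n, r ^+ n < e.
Proof.
move=> /andP[r0 r1] e0.
have : r ^+ n @[n --> \oo] --> 0 by apply: cvg_expr; rewrite gtr0_norm.
move=> /cvgrPdist_lt /(_ e e0)[n _ /(_ n (leqnn _))] /=.
by rewrite sub0r normrN gtr0_norm ?exprn_gt0 //; exists n.
Qed.

Lemma curve_op_fixpoint p : 0 < p < 1 ->
  exists M, [/\ supp01 M, unif_continuous M & forall t, M t = curve_op p M t].
Proof.
move=> p01; have /andP[p0 p1] := p01.
pose r := Num.max p (1 - p).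
have pr : p <= r by rewrite le_max lexx.
have qr : 1 - p <= r by rewrite le_max lexx orbT.
have r01 : 0 < r < 1 by rewrite lt_max p0 gt_max p1; lra.
have /andP[r0 r1] := r01; have r1' : 0 < 1 - r by lra.
pose T m := iter m (curve_op p) (fun=> 0).
have Ts m : supp01 (T m).
  by elim: m => [|m IH] //; exact: curve_op_supp.
have Tu m : unif_continuous (T m).
  elim: m => [|m IH]; last exact: curve_op_unif.
  apply/unif_continuous_realP => e e0; exists 1 => // x y _.
  by rewrite subrr normr0.
have Td t m : `|T m.+1 t - T m t| <= r ^+ m.
  elim: m t => [|m IH] t; last first.
    by rewrite exprS; exact: (curve_op_contract p01 pr qr (Ts m.+1) (Ts m) IH).
  rewrite /= subr0 expr0; have [t01|t01] := boolP (0 < t < 1); last first.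
    by rewrite (curve_op_supp p01 _ t01) ?normr0.
  case/andP: t01 => t0 t1; have [tp|tp] := leP t p.
    rewrite curve_op_left ?(ltW t0) // mulr0 add0r ger0_norm.
      by rewrite ler_pdivrMr // mul1r.
    by rewrite divr_ge0 // ltW.
  rewrite curve_op_right ?(ltW tp) ?(ltW t1) // mulr0 add0r ger0_norm.
    by rewrite ler_pdivrMr ?mul1r; lra.
  by rewrite divr_ge0; lra.
have [M MT] := choice (fun t => geometric_cauchy_lim r01 (Td t)).
have small e : 0 < e -> exists n, r ^+ n / (1 - r) < e.
  move=> e0; have [n rn] := expr_lt_eps r01 (mulr_gt0 e0 r1').
  by exists n; rewrite ltr_pdivrMr.
have small0 (a k : R) : 0 < k -> (forall n, `|a| <= k * (r ^+ n / (1 - r))) ->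
  a = 0.
  move=> k0 h; apply/eqP; rewrite -normr_le0 leNgt; apply/negP => a0.
  have [n hn] := small (`|a| / k) (divr_gt0 a0 k0).
  by have := h n; rewrite leNgt mulrC -ltr_pdivlMr // hn.
have Ms : supp01 M.
  move=> x x01; apply: (small0 _ 1) => // n.
  by have := MT x n; rewrite Ts // subr0 mul1r.
exists M; split => //.
- apply/unif_continuous_realP => e e0.
  have [|n hn] := small (e / 3); first lra.
  have /unif_continuous_realP /(_ (e / 3)) [|d d0 hd] := Tu n; first lra.
  exists d => // x y /hd; have := MT x n; have := MT y n.
  rewrite [`|M y - _|]distrC => h1 h2 h3.
  rewrite (_ : M x - M y = (M x - T n x) + (T n x - T n y) + (T n y - M y));
    last by ring.
  apply: (le_lt_trans (ler_normD _ _)).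
  have := ler_normD (M x - T n x) (T n x - T n y); lra.
- move=> t; apply/eqP; rewrite -subr_eq0; apply/eqP.
  apply: (small0 _ 2) => // n.
  have h1 := MT t n.+1.
  have h2 := curve_op_contract p01 pr qr (Ts n) Ms (c := r ^+ n / (1 - r)) _ t.
  rewrite (_ : M t - _ = (M t - T n.+1 t) + (curve_op p (T n) t - curve_op p M
    t)); last by rewrite /T /=; ring.
  apply: (le_trans (ler_normD _ _)).
  have h3 : `|curve_op p (T n) t - curve_op p M t| <= r * (r ^+ n / (1 - r)).
    by apply: h2 => s; rewrite distrC.
  move: h1; rewrite exprS -mulrA => h1.
  have cn : 0 < r ^+ n / (1 - r) by rewrite divr_gt0 // exprn_gt0.
  have : r * (r ^+ n / (1 - r)) <= 1 * (r ^+ n / (1 - r)).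
    by rewrite ler_pM2r // ltW.
  lra.
Qed.

End Blancmange.

(** * Uniqueness of the attractor, and the essential supremum norm *)

Section Attractor.
Context {R : realType}.
Variables (p : R) (M : R -> R).
Hypotheses (p01 : 0 < p < 1) (Ms : supp01 M) (Mu : unif_continuous M)
  (Mfix : forall t, M t = curve_op p M t).

Let Mc : continuous M. Proof. exact: unif_continuous_real. Qed.

Let p0 : 0 < p. Proof. by case/andP: p01. Qed.
Let q0 : 0 < 1 - p. Proof. by case/andP: p01 => _; rewrite subr_gt0. Qed.

Definition graph01 : set (R * R) := [set z | 0 <= z.1 <= 1 /\ z.2 = M z.1].

Let M_alphaL x : 0 <= x <= 1 -> M (p * x) = p * M x + x.
Proof.
move=> /andP[x0 x1].
have e : p * x / p = x by rewrite mulrAC mulfV ?mul1r // gt_eqF.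
rewrite Mfix curve_op_left // ?e //.
by apply/andP; split; [rewrite mulr_ge0 // ltW|rewrite ler_piMr // ltW].
Qed.

Let M_alphaR x : 0 <= x <= 1 ->
  M ((1 - p) * x + p) = (1 - p) * M x - x + 1.
Proof.
move=> /andP[x0 x1].
have e : (1 - ((1 - p) * x + p)) / (1 - p) = 1 - x.
  by field; rewrite gt_eqF.
rewrite Mfix curve_op_right // ?e ?subKr; first by ring.
have h1 : 0 <= (1 - p) * x by rewrite mulr_ge0 // ltW.
have h2 : (1 - p) * x <= 1 - p by rewrite ler_piMr // ltW.
by apply/andP; split; lra.
Qed.

(** The vertical distance to the graph has a maximum on the compact set E, and
the maximum is at most p or 1 - p times another value of that distance. *)
Lemma attractor_sub_graph E : is_attractor p E -> E `<=` graph01.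
Proof.
move=> [E0 Ec E01 Efix].
pose f (z : R * R) := `|z.2 - M z.1|.
have fc : continuous f.
  move=> z; apply: cvg_norm; apply: cvgB; first exact: cvg_snd.
  by apply: (@continuous_comp _ _ _ fst M); [exact: cvg_fst|exact: Mc].
have [z zE zmax] := compact_EVT_max E0 Ec (continuous_subspaceT fc).
have fz0 : f z <= 0.
  have step c w : 0 < c < 1 -> E w -> f z <= c * f w -> f z <= 0.
    move=> /andP[c0 c1] wE; have := zmax w; rewrite inE => /(_ wE) h1 h2.
    have : c * f w <= c * f z by rewrite ler_pM2l.
    move: h2; have : 0 <= f z by exact: normr_ge0.
    move=> g0 g1 g2; have : (1 - c) * f z <= 0 by lra.
    by rewrite pmulr_rle0 // subr_gt0.
  move: zE; rewrite inE Efix => -[] [w wE ew].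
    apply: (step p w) => //; rewrite -ew /f /alphaL /= M_alphaL; last first.
      by have [/= + _] := E01 _ wE; rewrite in_itv.
    by rewrite opprD addrACA subrr addr0 -mulrBr normrM (gtr0_norm p0).
  apply: (step (1 - p) w) => //; first by case/andP: p01 => ? ?; lra.
  rewrite -ew /f /alphaR /= M_alphaR; last first.
    by have [/= + _] := E01 _ wE; rewrite in_itv.
  rewrite (_ : _ - _ = (1 - p) * (w.2 - M w.1)); last by ring.
  by rewrite normrM (gtr0_norm q0).
move=> w wE; split; first by have [/= + _] := E01 _ wE; rewrite in_itv.
apply/eqP; rewrite -subr_eq0 -normr_le0; apply: le_trans fz0.
by apply: zmax; rewrite inE.
Qed.

(** The abscissas of E form a closed set stable under the two contractions
x |-> p x and x |-> (1 - p) x + p, whose images cover [0, 1]; hence they come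
within r ^ m of every point of [0, 1]. *)
Lemma graph_sub_attractor E : is_attractor p E -> graph01 `<=` E.
Proof.
move=> attE; have [E0 Ec E01 Efix] := attE => -[x y] [/= x01 ->].
pose r := Num.max p (1 - p).
have pr : p <= r by rewrite le_max lexx.
have qr : 1 - p <= r by rewrite le_max lexx orbT.
have r01 : 0 < r < 1 by rewrite lt_max p0 gt_max; case/andP: p01 => ? ?;
  apply/andP; split; lra.
have approx m : forall x, 0 <= x <= 1 -> exists2 z, E z & `|z.1 - x| <= r ^+ m.
  elim: m => [|m IH] {x01}x /andP[x0 x1].
    have [z zE] := E0; exists z => //; have [/= + _] := E01 _ zE.
    by rewrite in_itv /= expr0 ler_norml => /andP[? ?]; apply/andP; split; lra.
  have [xp|xp] := leP x p.
    have [|z zE hz] := IH (x / p).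
      by rewrite divr_ge0 ?(ltW p0) //= ler_pdivrMr // mul1r.
    exists (alphaL p z); first by rewrite Efix; left; exists z.
    rewrite /alphaL /= (_ : _ - _ = p * (z.1 - x / p)).
      by rewrite normrM (gtr0_norm p0) exprS ler_pM // ltW.
    by field; rewrite gt_eqF.
  have [|z zE hz] := IH ((x - p) / (1 - p)).
    rewrite ler_pdivlMr // mul0r ler_pdivrMr // mul1r; apply/andP; split; lra.
  exists (alphaR p z); first by rewrite Efix; right; exists z.
  rewrite /alphaR /= (_ : _ - _ = (1 - p) * (z.1 - (x - p) / (1 - p))).
    by rewrite normrM (gtr0_norm q0) exprS ler_pM // ltW.
  by field; rewrite gt_eqF.
have cl : closed (fst @` E).
  apply: compact_closed; first exact: Rhausdorff.
  apply: continuous_compact => //; apply: continuous_subspaceT => z.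
  exact: cvg_fst.
have [z zE zx] : (fst @` E) x.
  apply: cl => B [e /= e0 eB].
  have [m hm] := expr_lt_eps r01 e0; have [z zE hz] := approx m x x01.
  exists z.1; split; first by exists z.
  by apply: eB; rewrite /ball /= distrC; apply: le_lt_trans hm.
have [_ ez] := attractor_sub_graph attE zE.
by move: ez; rewrite zx => <-; rewrite -zx; case: z zE {zx}.
Qed.

Lemma is_attractor_graph : is_attractor p graph01.
Proof.
have M0 : M 0 = 0 by rewrite Ms // ltxx.
split.
- by exists (0, M 0); rewrite /graph01 /= lexx ler01.
- have -> : graph01 = (fun x => (x, M x)) @` `[0, 1].
    apply/seteqP; split => [[x y] [/= x01 ->]|_ [x /= + <-]].
      by exists x => //=; rewrite in_itv.
    by rewrite in_itv.
  apply: continuous_compact (@segment_compact _ _ _).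
  apply: continuous_subspaceT => x;
    apply: (@cvg_pair _ _ _ _ (nbhs x) (nbhs (M x))).
    exact: cvg_id.
  exact: Mc.
- by move=> [x y] [/= x01 _]; rewrite in_itv.
- apply/seteqP; split => [[x y] [/= /andP[x0 x1] ->]|z].
    have [xp|xp] := leP x p.
      left; exists (x / p, M (x / p)).
        by split=> //=; rewrite divr_ge0 ?(ltW p0) //= ler_pdivrMr // mul1r.
      have h : 0 <= x / p <= 1.
        by rewrite divr_ge0 ?(ltW p0) //= ler_pdivrMr // mul1r.
      by rewrite /alphaL /= -M_alphaL // mulrCA mulfV ?mulr1 // gt_eqF.
    have h : 0 <= (x - p) / (1 - p) <= 1.
      by rewrite ler_pdivlMr // mul0r ler_pdivrMr // mul1r; apply/andP;
        split; lra.
    right; exists ((x - p) / (1 - p), M ((x - p) / (1 - p))) => //.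
    rewrite /alphaR /= -M_alphaR // mulrCA mulfV ?mulr1 ?gt_eqF //.
    by rewrite subrK.
  case=> -[[x y] [/= x01 ->] <-]; rewrite /alphaL /alphaR /graph01 /=.
    rewrite M_alphaL //; split => //.
    case/andP: x01 p01 => x0 x1 /andP[_ p1].
    by rewrite mulr_ge0 ?(ltW p0) //= mulr_ile1 // ltW.
  rewrite M_alphaR //; split => //.
  case/andP: x01 => x0 x1;
    have h1 : 0 <= (1 - p) * x by rewrite mulr_ge0 // ltW.
  have h2 : (1 - p) * x <= 1 - p by rewrite ler_piMr // ltW.
  by apply/andP; split; have := p0; lra.
Qed.

Lemma attractorE : attractor p = graph01.
Proof.
have := xgetPex set0 (ex_intro [set E | is_attractor p E] _ is_attractor_graph).
rewrite -/(attractor p) => att; apply/seteqP; split.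
  exact: attractor_sub_graph.
exact: graph_sub_attractor.
Qed.

Lemma McurveE x : 0 <= x <= 1 -> Mcurve p x = M x.
Proof.
move=> x01; rewrite /Mcurve attractorE.
have /(xgetPex 0)[_] : exists y, [set y | graph01 (x, y)] y by exists (M x).
by [].
Qed.

Lemma Mcurve_patch : Mcurve p \_ `[0, 1] = M.
Proof.
apply/funext => x; rewrite patchE; case: ifPn => [|xN].
  by rewrite inE /= in_itv => /McurveE.
rewrite Ms //; apply: contra xN => /andP[x0 x1].
by rewrite inE /= in_itv /= !ltW.
Qed.

End Attractor.

Section Linfty.
Context {R : realType}.
Implicit Types (f : R -> R).

Let mu := @lebesgue_measure R.

Let mu_setT_gt0 : (0 < mu setT)%E.
Proof. by rewrite /mu -set_itvNyy lebesgue_measure_itv /= addye // ltry. Qed.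

Lemma Linfty_normE f :
  Linfty_norm f = ess_sup mu (EFin \o (fun x => `|(f \_ `[0, 1]) x|)).
Proof. by rewrite /Linfty_norm unlock /= mu_setT_gt0. Qed.

Lemma Linfty_norm_ge0 f : (0 <= Linfty_norm f)%E.
Proof.
rewrite Linfty_normE; apply: ess_sup_ger => //.
Qed.

Lemma Linfty_norm_le f (c : R) : 0 <= c ->
  (forall t, 0 <= t <= 1 -> `|f t| <= c) -> (Linfty_norm f <= c%:E)%E.
Proof.
move=> c0 fc; rewrite Linfty_normE; apply: ess_sup_ler => x.
rewrite lee_fin patchE; case: ifPn; last by rewrite normr0.
by rewrite inE /= in_itv /= => /fc.
Qed.

(** A continuous function exceeding a value somewhere exceeds it on an
interval, which is not negligible. *)
Lemma Linfty_norm_cont f t : continuous (f \_ `[0, 1]) ->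
  ((`|(f \_ `[0, 1]) t|)%:E <= Linfty_norm f)%E.
Proof.
set h := f \_ _ => hc; rewrite Linfty_normE; set s := ess_sup _ _.
rewrite leNgt; apply/negP => st.
have [N [mN N0 hN]] := ess_sup_ge mu (EFin \o (fun x => `|h x|)).
have [y sy] : exists2 y : R, (s <= y%:E)%E & y < `|h t|.
  case: s st {hN} => [y| |] //; first by exists y; rewrite -?lte_fin.
  by exists (`|h t| - 1); rewrite ?leNye //; lra.
move=> yt.
have [e /= e0 eB] : \forall x \near t, y < `|h x|.
  by apply: (cvgr_gt _ (cvg_norm (hc t))).
have : `]t - e, t + e[ `<=` N.
  move=> x /=; rewrite in_itv /= => /andP[x1 x2]; apply: hN => /=.
  apply/negP; rewrite -ltNge; apply: le_lt_trans sy _; rewrite lte_fin.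
  by apply: eB; rewrite /ball /= ltr_distlC; apply/andP; split; lra.
move=> sub; have : (mu `](t - e)%R, (t + e)%R[%classic <= 0)%E.
  rewrite -N0; apply: le_measure => //; rewrite inE //.
rewrite /mu lebesgue_measure_itv /= lte_fin.
have -> : t - e < t + e by lra.
by rewrite -EFinD lee_fin; lra.
Qed.

End Linfty.

(** * Deviations along words *)

Section Words.
Context {R : realType}.
Implicit Types (u v w : seq R) (s t : R).

Definition word_sum w l : R := \sum_(x <- take l w) x.

(** Beyond the size of w the partial sums are constant; so the value at the
right end, where the truncation is size w, needs no special case. *)
Definition word_interp w s : R :=
  let l := Num.truncn s in
  word_sum w l + (s - l%:R) * (word_sum w l.+1 - word_sum w l).

Definition word_total w : R := \sum_(x <- w) x.

Definition word_dev w t : R :=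
  word_interp w (t * (size w)%:R) - t * word_total w.

Lemma word_sum_oversize w l : (size w <= l)%N -> word_sum w l = word_total w.
Proof. by move=> h; rewrite /word_sum take_oversize. Qed.

Lemma word_interp_size w : word_interp w (size w)%:R = word_total w.
Proof.
by rewrite /word_interp natrK !word_sum_oversize // subrr mul0r addr0.
Qed.

Lemma word_total_cat u v : word_total (u ++ v) = word_total u + word_total v.
Proof. by rewrite /word_total big_cat. Qed.

Lemma word_interp_catl u v s : 0 <= s <= (size u)%:R ->
  word_interp (u ++ v) s = word_interp u s.
Proof.
move=> /andP[s0]; rewrite le_eqVlt => /orP[/eqP ->|su].
  rewrite word_interp_size /word_interp natrK subrr mul0r addr0.
  by rewrite /word_sum take_size_cat.
have hl : (Num.truncn s < size u)%N by rewrite truncn_lt_nat.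
by rewrite /word_interp /word_sum !takel_cat // ltnW.
Qed.

Lemma word_interp_catr u v s : 0 <= s ->
  word_interp (u ++ v) ((size u)%:R + s) = word_total u + word_interp v s.
Proof.
move=> s0; rewrite /word_interp.
have -> : Num.truncn ((size u)%:R + s) = (size u + Num.truncn s)%N.
  by rewrite truncnD ?natr_nat // natrK.
have tk l : word_sum (u ++ v) (size u + l) = word_total u + word_sum v l.
  rewrite /word_sum take_cat ltnNge leq_addr /= addKn.
  exact: word_total_cat.
by rewrite -addnS !tk natrD; ring.
Qed.

(** With word_dev_catr: the chords of u and v make with the chord of u ++ v a
triangle whose apex, above q, has the height given by the last factor. *)
Lemma word_dev_catl u v t (a := (size u)%:R : R) (b := (size v)%:R : R)
    (q := a / (a + b)) :
  (0 < size u)%N -> 0 <= t <= q ->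
  word_dev (u ++ v) t = word_dev u (t / q)
    + t / q * ((1 - q) * word_total u - q * word_total v).
Proof.
move=> u0 /andP[t0 tq]; have a0 : 0 < a by rewrite ltr0n.
have b0 : 0 <= b by rewrite ler0n.
have ab0 : 0 < a + b by lra.
have e : t * (a + b) = t / q * a.
  by rewrite /q; field; rewrite !gt_eqF.
rewrite /word_dev size_cat natrD -/a -/b word_interp_catl; last first.
  apply/andP; split; first by rewrite mulr_ge0 // ltW.
  by rewrite -ler_pdivlMr.
rewrite word_total_cat e; move: e; rewrite /q => e.
field; rewrite ?gt_eqF //.
Qed.

Lemma word_dev_catr u v t (a := (size u)%:R : R) (b := (size v)%:R : R)
    (q := a / (a + b)) :
  (0 < size v)%N -> q <= t ->
  word_dev (u ++ v) t = word_dev v (1 - (1 - t) / (1 - q))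
    + (1 - t) / (1 - q) * ((1 - q) * word_total u - q * word_total v).
Proof.
move=> v0 tq; have b0 : 0 < b by rewrite ltr0n.
have a0 : 0 <= a by rewrite ler0n.
have ab0 : 0 < a + b by lra.
have q1 : 1 - q = b / (a + b) by rewrite /q; field; rewrite gt_eqF.
have e : t * (a + b) = a + (1 - (1 - t) / (1 - q)) * b.
  by rewrite q1; field; rewrite !gt_eqF.
have s0 : 0 <= (1 - (1 - t) / (1 - q)) * b.
  by move: tq; rewrite /q ler_pdivrMr // e; lra.
rewrite /word_dev size_cat natrD -/a -/b e word_interp_catr //.
rewrite word_total_cat q1 /q; field; rewrite ?gt_eqF //.
Qed.

Definition word_norm w : R := \sum_(x <- w) `|x|.

Lemma word_sum_le w l : `|word_sum w l| <= word_norm w.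
Proof.
apply: (le_trans (ler_norm_sum _ _ _)).
rewrite /word_norm -[X in _ <= \sum_(_ <- X) _](cat_take_drop l) big_cat /=.
by rewrite lerDl sumr_ge0.
Qed.

Lemma word_dev_le w t : 0 <= t <= 1 -> `|word_dev w t| <= 4 * word_norm w.
Proof.
move=> /andP[t0 t1]; rewrite /word_dev /word_interp.
set s := t * _; set l := Num.truncn s.
have s0 : 0 <= s by rewrite mulr_ge0.
have /andP[ls sl] := truncn_itv s0.
have h1 := word_sum_le w l; have h2 := word_sum_le w l.+1.
have h3 : `|word_total w| <= word_norm w.
  by rewrite -(word_sum_oversize (leqnn _)) word_sum_le.
set x := word_sum _ _ in h1 *; set y := word_sum _ _ in h2 *.
have e1 : `|(s - l%:R) * (y - x)| <= `|y| + `|x|.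
  rewrite normrM; apply: le_trans (ler_normB _ _).
  rewrite ler_piMl // ger0_norm ?subr_ge0 //.
  by move: sl; rewrite -/l -natr1; lra.
have e2 : `|t * word_total w| <= `|word_total w|.
  by rewrite normrM ler_piMl // ger0_norm.
apply: (le_trans (ler_normB _ _)).
have := ler_normD x ((s - l%:R) * (y - x)); lra.
Qed.

End Words.

Section TowerWords.
Context {R : realType}.
Variables (N : nat) (g : R -> R).
Hypothesis mg : dyadic_measurable N g.
Implicit Types (n k : nat).

Definition tower_word n k : seq R := map g (tower n k).

Lemma size_tower_word n k : size (tower_word n k) = 'C(n, k).
Proof. by rewrite size_map size_tower. Qed.

Lemma tower_word_small n k : (n < k)%N -> tower_word n k = [::].
Proof. by move=> h; apply: size0nil; rewrite size_tower_word bin_small. Qed.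

Lemma dyadic_right_half n i : (N <= n)%N -> (i < 2 ^ n)%N ->
  g (i%:R * 2^-1 ^+ n + 2^-1 ^+ n.+1) = g (i%:R * 2^-1 ^+ n).
Proof.
move=> Nn ni; have h0 : 0 < (2^-1 : R) ^+ n by rewrite exprn_gt0 // invr_gt0.
apply: (mg (i := (i %/ 2 ^ (n - N))%N)).
- by rewrite ltn_divLR ?expn_gt0 // -expnD subnKC.
- apply: rung_coarse => //; rewrite /rung /= in_itv /= exprS.
  by apply/andP; split; lra.
- apply: rung_coarse => //; rewrite /rung /= in_itv /=.
  by apply/andP; split; lra.
Qed.

(** The rungs of the left factor are right halves of rungs, on which g takes
the same values once the stage is fine enough. *)
Lemma tower_wordS n k : (N <= n)%N ->
  tower_word n.+1 k.+1 = tower_word n k ++ tower_word n k.+1.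
Proof.
move=> Nn; rewrite /tower_word /= map_cat -map_comp; congr (_ ++ _).
apply/eq_in_map => a /(nthP 0)[j hj <-] /=.
by have [i hi ->] := tower_dyadic hj; exact: dyadic_right_half.
Qed.

Lemma tower_word0 n : tower_word n.+1 0 = tower_word n 0.
Proof. by []. Qed.

Lemma birkhoff_sum_word n k l : (l <= 'C(n, k))%N ->
  birkhoff_sum g (base n k) l = word_sum (tower_word n k) l.
Proof.
move=> hl; rewrite /birkhoff_sum /word_sum.
have sz : size (take l (tower_word n k)) = l.
  by rewrite size_takel // size_tower_word.
rewrite [RHS](big_nth 0) sz !big_nat; apply: eq_bigr => j /andP[_ jl].
have hj : (j < size (@tower R n k))%N by rewrite size_tower (leq_trans jl).
rewrite nth_take // (nth_map 0) //; congr g.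
have h0 : 0 < (2^-1 : R) ^+ n by rewrite exprn_gt0 // invr_gt0.
have eb : base n k = (tower n k)`_0 :> R by rewrite nth0.
have hb : @rung R n (tower n k)`_0 (base n k).
  by rewrite eb /rung /= in_itv /=; apply/andP; split; lra.
have [-> _] := iter_pascal hj hb.
by rewrite eb; ring.
Qed.

Lemma F_word n k (s : R) : 0 <= s <= 'C(n, k)%:R ->
  F g n k s = word_interp (tower_word n k) s.
Proof.
move=> /andP[s0]; rewrite le_eqVlt => /orP[/eqP ->|sC].
  rewrite /F -size_tower_word word_interp_size natrK subrr mul0r addr0.
  by rewrite birkhoff_sum_word ?size_tower_word // word_sum_oversize
    ?size_tower_word.
have hl : (Num.truncn s < 'C(n, k))%N by rewrite truncn_lt_nat.
by rewrite /F /word_interp !birkhoff_sum_word // ltnW.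
Qed.

Lemma F_total n k : F g n k 'C(n, k)%:R = word_total (tower_word n k).
Proof.
by rewrite F_word ?lexx ?ler0n // -size_tower_word word_interp_size.
Qed.

Lemma F_dev_word n k (t : R) : 0 <= t <= 1 ->
  F_dev g n k t = word_dev (tower_word n k) t.
Proof.
move=> /andP[t0 t1]; rewrite /F_dev F_total F_word ?size_tower_word //.
  by rewrite /word_dev size_tower_word.
by rewrite mulr_ge0 //= ler_piMl.
Qed.

End TowerWords.

(** * A filter for k/n tending to p *)

Section RatioFilter.
Context {R : realType}.
Implicit Types (p e : R) (z : nat * nat).

(** The filter on pairs (n, k) generated by n -> oo and k/n -> p; a single
parameter e controls both conditions. *)
Definition ratio_nbhs p : set_system (nat * nat) :=
  filter_from [set e : R | 0 < e]
    (fun e => [set z | e^-1 <= z.1%:R /\ `|p - z.2%:R / z.1%:R| < e]).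

Global Instance ratio_nbhs_filter p : Filter (ratio_nbhs p).
Proof.
apply: filter_from_filter; first by exists 1 => /=.
move=> e f /= e0 f0; exists (Num.min e f); first by rewrite lt_min e0.
have m0 : 0 < Num.min e f by rewrite lt_min e0.
move=> z [/= z1 z2]; split; split.
- by apply: le_trans z1; rewrite lef_pV2 ?posrE // ge_min lexx.
- by apply: lt_le_trans z2 _; rewrite ge_min lexx.
- by apply: le_trans z1; rewrite lef_pV2 ?posrE // ge_min lexx orbT.
- by apply: lt_le_trans z2 _; rewrite ge_min lexx orbT.
Qed.

Lemma ratio_nbhs_ge p (m : nat) : \forall z \near ratio_nbhs p, (m <= z.1)%N.
Proof.
exists (m.+1%:R)^-1 => /=; first by rewrite invr_gt0.
by move=> z [/= + _]; rewrite invrK ler_nat => /ltnW.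
Qed.

Lemma ratio_nbhs_ratio p : z.2%:R / z.1%:R @[z --> ratio_nbhs p] --> p.
Proof. by apply/cvgrPdist_lt => e e0; exists e => // z []. Qed.

Lemma ratio_nbhs_inv p : z.1%:R^-1 @[z --> ratio_nbhs p] --> (0 : R).
Proof.
apply/cvgrPdist_lt => e e0; exists (e / 2) => /=; first by rewrite divr_gt0.
move=> z [/= z1 _]; have i0 : 0 < (e / 2)^-1 by rewrite invr_gt0 divr_gt0.
have z0 : 0 < z.1%:R :> R by apply: lt_le_trans z1.
rewrite sub0r normrN gtr0_norm ?invr_gt0 //.
apply: le_lt_trans (_ : e / 2 < e); last lra.
by rewrite -[e / 2]invrK lef_pV2 ?posrE.
Qed.

Lemma cvg_ratio_nbhs {T : Type} (F : set_system T) {FF : Filter F} p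
    (f : T -> nat * nat) :
  (forall m, \forall x \near F, (m <= (f x).1)%N) ->
  (f x).2%:R / (f x).1%:R @[x --> F] --> p ->
  f @ F --> ratio_nbhs p.
Proof.
move=> f1 /cvgrPdist_lt f2 A [e /= e0 eA].
have := f2 e e0; apply: filterS2 (f1 (Num.bound e^-1)) => x x1 x2.
apply: eA; split => //=.
apply: ltW; apply: lt_le_trans (archi_boundP _) _;
  first by rewrite invr_ge0 ltW.
by rewrite ler_nat.
Qed.

Lemma ratio_nbhs_lt p : 0 < p < 1 ->
  \forall z \near ratio_nbhs p, (0 < z.2 < z.1)%N.
Proof.
move=> /andP[p0 p1]; near=> z.
have zn : (1 <= z.1)%N by near: z; exact: ratio_nbhs_ge.
have z0 : 0 < z.2%:R / z.1%:R :> R.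
  by near: z; exact: cvgr_gt (ratio_nbhs_ratio (p := p)) _ p0.
have z1 : z.2%:R / z.1%:R < 1 :> R.
  by near: z; exact: cvgr_lt (ratio_nbhs_ratio (p := p)) _ p1.
have n0 : 0 < z.1%:R :> R by rewrite ltr0n.
move: z1 z0; rewrite ltr_pdivrMr // mul1r ltr_nat => -> /=.
by rewrite pmulr_lgt0 ?invr_gt0 // ltr0n => ->.
Unshelve. all: by end_near. Qed.

(** Going down one stage, to either of the two stacked towers, stays close to
the ray of slope p. *)
Lemma ratio_nbhs_pred p : 0 < p < 1 ->
  (fun z => (z.1.-1, z.2)) @ ratio_nbhs p --> ratio_nbhs p /\
  (fun z => (z.1.-1, z.2.-1)) @ ratio_nbhs p --> ratio_nbhs p.
Proof.
move=> p01.
have pred_ge m : \forall z \near ratio_nbhs p, (m <= z.1.-1)%N.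
  by apply: filterS (ratio_nbhs_ge p m.+1) => z; case: z.1.
have sm1 : 1 - z.1%:R^-1 @[z --> ratio_nbhs p] --> (1 : R).
  by rewrite -[X in _ --> X]subr0; apply: cvgB (cvg_cst _) (ratio_nbhs_inv p).
split; apply: cvg_ratio_nbhs => //=.
  have : (z.2%:R / z.1%:R) / (1 - z.1%:R^-1) @[z --> ratio_nbhs p] --> p / 1.
    apply: cvgM; first exact: ratio_nbhs_ratio.
    by apply: cvgV; first exact: oner_neq0.
  rewrite divr1; apply: cvg_trans; apply: near_eq_cvg.
  apply: filterS (ratio_nbhs_ge p 2) => -[[|[|n]] k] //= _; field.
  by rewrite nat1r -natrD !pnatr_eq0.
have : (z.2%:R / z.1%:R - z.1%:R^-1) / (1 - z.1%:R^-1)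
    @[z --> ratio_nbhs p] --> (p - 0) / 1.
  apply: cvgM.
    by apply: cvgB; [exact: ratio_nbhs_ratio|exact: ratio_nbhs_inv].
  by apply: cvgV; first exact: oner_neq0.
rewrite divr1 subr0; apply: cvg_trans; apply: near_eq_cvg.
apply: filterS2 (ratio_nbhs_ge p 2) (ratio_nbhs_lt p01).
move=> -[[|[|n]] [|k]] //= _ _; field.
by rewrite nat1r -natrD !pnatr_eq0.
Qed.

End RatioFilter.

(** * Binomial coefficients *)

Section Binomial.
Context {R : realType}.
Implicit Types (m n k l N : nat) (p : R).

(** The test avoids the junk value C(m, 0) = 1 that truncated subtraction would
give for l > k. *)
Definition bin_shift m k l := if (l <= k)%N then 'C(m, k - l) else 0%N.

Lemma bin_shiftS m k l :
  bin_shift m.+1 k.+1 l = (bin_shift m k l + bin_shift m k.+1 l)%N.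
Proof.
rewrite /bin_shift; have [lk|kl] := leqP l k.
  by rewrite leqW // subSn // binS addnC.
rewrite add0n leq_eqVlt ltnS leqNgt kl orbF.
by case: eqP => // ->; rewrite subnn !bin0.
Qed.

Lemma bin_shiftS0 m l : bin_shift m.+1 0 l = bin_shift m 0 l.
Proof. by rewrite /bin_shift; case: l => //=; rewrite !bin0. Qed.

Lemma bin_shift_le m k l N : (l <= N)%N -> (bin_shift m k l <= 'C(m + N, k))%N.
Proof.
rewrite /bin_shift; case: ifP => // lk /subnK <-.
elim: (N - l)%N => [|d IH]; last first.
  by rewrite addSn addnS (leq_trans IH) // leq_bin2l.
rewrite add0n; elim: l k lk => [|l IH] k lk; first by rewrite subn0 addn0.
case: k lk => // k lk; rewrite subSS addnS binS.
by rewrite (leq_trans (IH k lk)) // leq_addl.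
Qed.

Lemma bin_shift_diag m k l :
  m.+1%:R * (bin_shift m k l)%:R
    = (k.+1%:R - l%:R) * (bin_shift m.+1 k.+1 l)%:R :> R.
Proof.
rewrite /bin_shift; have [lk|kl] := leqP l k.
  rewrite leqW // subSn // -natrB ?leqW // subSn // -!natrM.
  by rewrite -mul_bin_diag.
rewrite leq_eqVlt ltnS leqNgt kl orbF mulr0.
by case: eqP => [->|_]; rewrite ?subrr ?mul0r ?mulr0.
Qed.

(** The two terms on the left are nearly equal; this computes the cancellation
exactly, and N q - l is where the last factor of P^g comes from. *)
Lemma bin_shift_skew m k l N (q : R := k.+1%:R / (m + N).+1%:R) :
  (1 - q) * (bin_shift m k l)%:R - q * (bin_shift m k.+1 l)%:R
  = m.+1%:R^-1 * ((bin_shift m.+1 k.+1 l)%:R * (N%:R * q - l%:R)).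
Proof.
have e := bin_shift_diag m k l.
have m0 : m.+1%:R != 0 :> R by rewrite pnatr_eq0.
have n0 : (m + N).+1%:R != 0 :> R by rewrite pnatr_eq0.
have qn : k.+1%:R = q * (m + N).+1%:R by rewrite /q divfK.
move: e; rewrite qn (bin_shiftS m k l) natrD.
set b := (bin_shift m k l)%:R; set c := (bin_shift m k.+1 l)%:R => e.
apply: (mulfI m0); rewrite [RHS]mulrA mulfV // mul1r.
have -> : m.+1%:R * ((1 - q) * b - q * c) = m.+1%:R * b - m.+1%:R * q * (b + c)
  by ring.
by rewrite e -addSn natrD; ring.
Qed.

(** By induction on N: one step divides the binomial coefficient by that of a
predecessor, with ratio k/n or 1 - k/n. *)
Lemma bin_shift_ratio_lim p N l : 0 < p < 1 -> (l <= N)%N ->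
  (bin_shift (z.1 - N) z.2 l)%:R / 'C(z.1, z.2)%:R @[z --> ratio_nbhs p]
    --> p ^+ l * (1 - p) ^+ (N - l).
Proof.
move=> p01; have [predl predr] := ratio_nbhs_pred p01.
have binz : \forall z \near ratio_nbhs p, 'C(z.1, z.2)%:R != 0 :> R.
  apply: filterS (ratio_nbhs_lt p01) => z /andP[_ z21].
  by rewrite pnatr_eq0 -lt0n bin_gt0 ltnW.
elim: N l => [|N IH] l.
  rewrite leqn0 => /eqP ->; rewrite !expr0 mulr1.
  apply: (@cvg_trans _ (cst (1 : R) @ ratio_nbhs p)); last exact: cvg_cst.
  apply: near_eq_cvg.
  apply: filterS binz => z z0 /=.
  by rewrite /bin_shift !subn0 divff.
rewrite leq_eqVlt => /orP[/eqP ->|].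
  have := cvgM (cvg_comp _ _ predr (IH N (leqnn N))) (ratio_nbhs_ratio (p :=
    p)).
  rewrite !subnn !expr0 !mulr1 -exprSr => /(_ (ratio_nbhs_filter p)).
  apply: cvg_trans.
  apply: near_eq_cvg; apply: filterS2 binz (ratio_nbhs_lt p01).
  move=> -[[|n] [|k]] //= C0; rewrite ltnS => kn.
  have C1 : 'C(n, k)%:R != 0 :> R by rewrite pnatr_eq0 -lt0n bin_gt0 ltnW.
  have e : n.+1%:R * 'C(n, k)%:R = k.+1%:R * 'C(n.+1, k.+1)%:R :> R.
    by rewrite -!natrM -mul_bin_diag.
  have n0 : n.+1%:R != 0 :> R by rewrite pnatr_eq0.
  rewrite subSS {2}/bin_shift ltnS subSS -/(bin_shift _ _ _).
  have -> : k.+1%:R / n.+1%:R = 'C(n, k)%:R / 'C(n.+1, k.+1)%:R :> R.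
    by apply/eqP; rewrite eqr_div // -e mulrC.
  by rewrite mulrA divfK.
rewrite ltnS => lN.
have l1 : 1 - z.2%:R / z.1%:R @[z --> ratio_nbhs p] --> 1 - p.
  by apply: cvgB; [exact: cvg_cst|exact: ratio_nbhs_ratio].
have := cvgM (cvg_comp _ _ predl (IH l lN)) l1.
rewrite -mulrA -exprSr -subSn // => /(_ (ratio_nbhs_filter p)).
apply: cvg_trans.
apply: near_eq_cvg; apply: filterS2 binz (ratio_nbhs_lt p01).
move=> -[[|n] k] /= C0 /andP[_] // kn.
have C1 : 'C(n, k)%:R != 0 :> R by rewrite pnatr_eq0 -lt0n bin_gt0.
have n0 : n.+1%:R != 0 :> R by rewrite pnatr_eq0.
have e : n.+1%:R * 'C(n, k)%:R = (n.+1%:R - k%:R) * 'C(n.+1, k)%:R :> R.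
  by rewrite -natrB ?(ltnW kn) // -!natrM -mul_bin_down.
rewrite subSS.
have -> : 1 - k%:R / n.+1%:R = 'C(n, k)%:R / 'C(n.+1, k)%:R :> R.
  by apply: (mulIf C0); rewrite divfK //; apply: (mulfI n0); rewrite e; field.
by rewrite mulrA divfK.
Qed.

End Binomial.

(** * Totals, skews and bounds for the towers *)

Section TowerAsymptotics.
Context {R : realType}.
Variables (N : nat) (g : R -> R).
Hypothesis mg : dyadic_measurable N g.
Implicit Types (n k m : nat) (p t : R).

Definition tower_total n k : R := word_total (tower_word g n k).

Lemma tower_total_bin m k :
  tower_total (m + N) k
  = \sum_(0 <= l < N.+1) tower_total N l * (bin_shift m k l)%:R.
Proof.
elim: m k => [|m IH] k.
  rewrite add0n big_mkord.
  have bs (l : 'I_N.+1) : bin_shift 0 k l = (l == k :> nat).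
    by rewrite /bin_shift bin0n subn_eq0 eqn_leq; case: (l <= k)%N.
  have [kN|Nk] := ltnP k N.+1; last first.
    rewrite big1 => [|l _]; last first.
      by rewrite bs (ltn_eqF (leq_trans (ltn_ord l) Nk)) mulr0.
    by rewrite /tower_total tower_word_small // /word_total big_nil.
  rewrite (bigD1 (Ordinal kN)) // bs eqxx mulr1 big1 => [|l lk].
    by rewrite /= addr0.
  by rewrite bs (negbTE (lk : (l : nat) != k)) mulr0.
case: k => [|k]; rewrite addSn.
  rewrite {1}/tower_total tower_word0 -/(tower_total _ _) IH.
  by apply: eq_bigr => l _; rewrite bin_shiftS0.
rewrite {1}/tower_total (tower_wordS mg) ?leq_addl // word_total_cat.
rewrite -!/(tower_total _ _) !IH -big_split /=; apply: eq_bigr => l _.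
by rewrite bin_shiftS natrD mulrDr.
Qed.

(** The height of the tent created when tower [n, k+1] is stacked on tower
[n, k]. *)
Definition skew n k : R := let q := k.+1%:R / n.+1%:R in
  (1 - q) * tower_total n k - q * tower_total n k.+1.

Lemma skewE m k : skew (m + N) k = m.+1%:R^-1 *
  \sum_(0 <= l < N.+1) tower_total N l * ((bin_shift m.+1 k.+1 l)%:R
    * (N%:R * (k.+1%:R / (m + N).+1%:R) - l%:R)).
Proof.
rewrite /skew !tower_total_bin !mulr_sumr -sumrB; apply: eq_bigr => l _.
by rewrite !(mulrCA _ (tower_total N l)) -mulrBr bin_shift_skew.
Qed.

(** The factor N + 1 pays for replacing 1 / (n + 1 - N) by 1 / (n + 1). *)
Definition skew_const : R :=
  N%:R * N.+1%:R * \sum_(0 <= l < N.+1) `|tower_total N l|.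

Lemma skew_le n k : (N <= n)%N -> (k <= n)%N ->
  `|skew n k| <= skew_const * 'C(n.+1, k.+1)%:R / n.+1%:R.
Proof.
move=> Nn kn; have en : n = (n - N + N)%N by rewrite subnK.
set m := (n - N)%N in en; rewrite [in X in X <= _]en skewE -en.
set q := _ / _; have q01 : 0 <= q <= 1.
  by rewrite divr_ge0 //= ler_pdivrMr ?ltr0n // mul1r ler_nat.
have m0 : 0 < m.+1%:R^-1 :> R by rewrite invr_gt0 ltr0n.
have C0 : 0 <= 'C(n.+1, k.+1)%:R :> R by rewrite ler0n.
set S := \sum_(_ <= _ < _) _.
have hS : `|S| <= N%:R * 'C(n.+1, k.+1)%:R * \sum_(0 <= l < N.+1) `|tower_total
  N l|.
  apply: (le_trans (ler_norm_sum _ _ _)); rewrite mulr_sumr.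
  rewrite !big_nat; apply: ler_sum => l /andP[_ lN].
  rewrite normrM mulrC ler_wpM2r // normrM mulrC.
  apply: ler_pM => //; last first.
    by rewrite normr_nat ler_nat en -addSn; apply: bin_shift_le.
  case/andP: q01 => q0 q1.
  have h1 : N%:R * q <= N%:R by rewrite ler_piMr.
  have h0 : 0 <= N%:R * q by rewrite mulr_ge0.
  have h2 : l%:R <= N%:R :> R by rewrite ler_nat.
  have h3 : 0 <= l%:R :> R by [].
  by rewrite ler_norml; apply/andP; split; lra.
rewrite normrM (gtr0_norm m0).
have hm : m.+1%:R^-1 <= N.+1%:R / n.+1%:R :> R.
  rewrite ler_pdivlMr ?ltr0n // mulrC ler_pdivrMr ?ltr0n // -natrM ler_nat.
  rewrite {1}en mulSn mulnS; lia.
apply: le_trans (_ : N.+1%:R / n.+1%:R * `|S| <= _).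
  by rewrite ler_wpM2r.
rewrite /skew_const.
apply: (le_trans (ler_wpM2l (ltW (lt_le_trans m0 hm)) hS)).
by rewrite le_eqVlt; apply/orP; left; apply/eqP; ring.
Qed.

Lemma tower_word_ratio n k : (k <= n)%N ->
  (size (tower_word g n k))%:R
    / ((size (tower_word g n k))%:R + (size (tower_word g n k.+1))%:R)
  = k.+1%:R / n.+1%:R :> R.
Proof.
move=> kn; rewrite !size_tower_word -natrD addnC -binS.
have C0 : 'C(n.+1, k.+1)%:R != 0 :> R by rewrite pnatr_eq0 -lt0n bin_gt0.
by apply/eqP; rewrite eqr_div ?C0 ?pnatr_eq0 // -!natrM mulnC mul_bin_diag.
Qed.

Lemma tower_dev_left n k t (q := k.+1%:R / n.+1%:R : R) :
  (N <= n)%N -> (k <= n)%N -> 0 <= t <= q ->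
  word_dev (tower_word g n.+1 k.+1) t
  = word_dev (tower_word g n k) (t / q) + t / q * skew n k.
Proof.
move=> Nn kn tq; rewrite (tower_wordS mg) // word_dev_catl.
- by rewrite tower_word_ratio.
- by rewrite size_tower_word bin_gt0.
- by rewrite tower_word_ratio.
Qed.

Lemma tower_dev_right n k t (q := k.+1%:R / n.+1%:R : R) :
  (N <= n)%N -> (k < n)%N -> q <= t ->
  word_dev (tower_word g n.+1 k.+1) t
  = word_dev (tower_word g n k.+1) (1 - (1 - t) / (1 - q))
    + (1 - t) / (1 - q) * skew n k.
Proof.
move=> Nn kn tq; rewrite (tower_wordS mg) // word_dev_catr.
- by rewrite tower_word_ratio // ltnW.
- by rewrite size_tower_word bin_gt0.
- by rewrite tower_word_ratio // ltnW.
Qed.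

(** Equal to C(n + 2, k + 1) / (n + 2): of the order of C(n, k) / n when k/n is
away from 0 and 1, and yet 1 at k = 0 and k = n, where the word of the tower
does not depend on n. *)
Definition dev_bound n k : R :=
  'C(n, k)%:R * n.+1%:R / (k.+1%:R * (n - k).+1%:R).

(** With a = k + 1 and b = n - k, the bounds at (n, k), (n, k+1) and
(n+1, k+1) are c / (b + 1), c / (a + 1) and c (a + b + 1) / ((a + 1) (b + 1)).
  *)
Lemma dev_bound_step n k (c := 'C(n.+1, k.+1)%:R : R) : (k < n)%N ->
  dev_bound n k + c / (2 * n.+1%:R) <= dev_bound n.+1 k.+1 /\
  dev_bound n k.+1 + c / (2 * n.+1%:R) <= dev_bound n.+1 k.+1.
Proof.
move=> kn; rewrite /dev_bound subSS.
have e1 : 'C(n, k)%:R = k.+1%:R / n.+1%:R * c :> R.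
  by rewrite mulrAC -natrM -mul_bin_diag natrM mulrAC divff ?mul1r ?pnatr_eq0.
have e2 : 'C(n, k.+1)%:R = (n - k)%:R / n.+1%:R * c :> R.
  rewrite mulrAC -natrM -[(n - k)%N]subSS -mul_bin_down natrM mulrAC.
  by rewrite divff ?mul1r ?pnatr_eq0.
rewrite e1 e2 -/c.
have -> : (n - k.+1).+1 = (n - k)%N by rewrite -subSn.
have c0 : 0 <= c by [].
set a : R := k.+1%:R; set b : R := (n - k)%:R.
have a1 : 1 <= a by rewrite ler1n.
have b1 : 1 <= b by rewrite ler1n subn_gt0.
have nab : n.+1%:R = a + b by rewrite -natrD addSn subnKC // ltnW.
have -> : k.+2%:R = a + 1 :> R by rewrite natr1.
have -> : (n - k).+1%:R = b + 1 :> R by rewrite natr1.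
have -> : n.+2%:R = a + b + 1 by rewrite -nab natr1.
rewrite nab; have ab0 : 0 < a + b by lra.
have e3 : a / (a + b) * c * (a + b) / (a * (b + 1)) = c / (b + 1).
  by field; rewrite !gt_eqF //; lra.
have e4 : b / (a + b) * c * (a + b) / ((a + 1) * b) = c / (a + 1).
  by field; rewrite !gt_eqF //; lra.
rewrite e3 e4.
have hb : 0 < b + 1 by lra.
have ha : 0 < a + 1 by lra.
have key x y : 1 <= x -> 1 <= y -> x + y = a + b ->
  c / (x + 1) + c / (2 * (a + b)) <= c * (a + b + 1) / ((x + 1) * (y + 1)).
  move=> x1 y1 xy; rewrite -xy.
  have -> : c * (x + y + 1) / ((x + 1) * (y + 1)) = c / (x + 1) + c * (x / ((x
    + 1) * (y + 1))).
    by field; rewrite !gt_eqF //; lra.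
  rewrite lerD2l ler_wpM2l //.
  have h1 : 0 < 2 * (x + y) by lra.
  have h2 : 0 < (x + 1) * (y + 1) by rewrite mulr_gt0 //; lra.
  rewrite ler_pdivlMr // mulrC ler_pdivrMr //.
  have h3 : x + 1 <= 2 * x by lra.
  have h4 : y + 1 <= x + y by lra.
  have -> : x * (2 * (x + y)) = (2 * x) * (x + y) by ring.
  by apply: ler_pM => //; lra.
split; last by apply: key.
by rewrite (mulrC (a + 1)); apply: key => //; exact: addrC.
Qed.

(** The increments of dev_bound absorb the skew at every stage. *)
Lemma tower_dev_bound : exists K : R, forall n k t, (N <= n)%N -> (k <= n)%N ->
  0 <= t <= 1 -> `|word_dev (tower_word g n k) t| <= K * dev_bound n k.
Proof.
pose S : R := \sum_(0 <= k < N.+1) 4 * word_norm (tower_word g N k).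
pose K := S * (N.+1%:R * N.+1%:R) + 2 * skew_const.
have wn0 (w : seq R) : 0 <= word_norm w by exact: sumr_ge0.
have S0 : 0 <= S by apply: sumr_ge0 => k _; rewrite mulr_ge0.
have sc0 : 0 <= skew_const by rewrite !mulr_ge0 //; exact: sumr_ge0.
have K0 : 0 <= K.
  by apply: addr_ge0; [rewrite mulr_ge0|rewrite mulr_ge0].
have bnd0 n : dev_bound n 0 = 1.
  by rewrite /dev_bound bin0 subn0 !mul1r divff ?pnatr_eq0.
have bndn n : dev_bound n n = 1.
  by rewrite /dev_bound binn subnn mulr1 !mul1r divff ?pnatr_eq0.
exists K => n k t Nn; rewrite -(subnK Nn); move: (n - N)%N => {n Nn}m.
elim: m k t => [|m IH] k t kn t01.
  rewrite add0n; have kN : (k <= N)%N by [].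
  apply: (le_trans (word_dev_le _ t01)).
  have h1 : 4 * word_norm (tower_word g N k) <= S.
    rewrite /S big_mkord (bigD1 (Ordinal (kN : (k < N.+1)%N))) //= lerDl.
    by apply: sumr_ge0 => l _; rewrite mulr_ge0.
  apply: (le_trans h1).
  have d0 : 0 < k.+1%:R * (N - k).+1%:R :> R by rewrite mulr_gt0 ?ltr0n.
  rewrite /dev_bound mulrA ler_pdivlMr //.
  have h2 : k.+1%:R * (N - k).+1%:R <= N.+1%:R * N.+1%:R :> R.
    by rewrite ler_pM // ler_nat ltnS // leq_subr.
  have h3 : 1 <= 'C(N, k)%:R * N.+1%:R :> R.
    by rewrite -natrM ler1n muln_gt0 bin_gt0 kN.
  apply: le_trans (_ : S * (N.+1%:R * N.+1%:R) <= _);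
    first by rewrite ler_wpM2l.
  apply: le_trans (_ : K <= _); first by rewrite /K lerDl mulr_ge0.
  by rewrite ler_peMr.
rewrite addSn in kn *; set n := (m + N)%N in IH kn *.
have Nn : (N <= n)%N by rewrite leq_addl.
case: k kn => [|k] kn.
  by rewrite tower_word0 bnd0 -(bnd0 n); apply: IH.
move: kn; rewrite ltnS leq_eqVlt => /orP[/eqP ->|kn].
  rewrite (tower_wordS mg) // [tower_word _ _ n.+1]tower_word_small // cats0.
  by rewrite bndn -(bndn n); apply: IH.
have [s1 s2] := dev_bound_step kn.
have hs : `|skew n k| <= K * ('C(n.+1, k.+1)%:R / (2 * n.+1%:R)).
  apply: (le_trans (skew_le Nn (ltnW kn))).
  rewrite invfM (mulrCA _ 2^-1) -mulrA [leRHS]mulrA ler_wpM2r ?divr_ge0 // /K.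
  have : 0 <= S * (N.+1%:R * N.+1%:R) by rewrite mulr_ge0.
  lra.
pose q : R := k.+1%:R / n.+1%:R.
have q0 : 0 < q by rewrite divr_gt0 ?ltr0n.
have q1 : 0 < 1 - q by rewrite subr_gt0 /q ltr_pdivrMr ?ltr0n // mul1r ltr_nat.
have uA (u A : R) : 0 <= u <= 1 -> `|u * A| <= `|A|.
  by move=> /andP[u0 u1]; rewrite normrM ler_piMl // ger0_norm.
case/andP: t01 => t0 t1; have [tq|tq] := leP t q.
  have u01 : 0 <= t / q <= 1 by rewrite divr_ge0 ?(ltW q0) //= ler_pdivrMr //
    mul1r.
  rewrite tower_dev_left ?t0 ?(ltnW kn) // -/q.
  apply: (le_trans (ler_normD _ _)).
  apply: le_trans (ler_wpM2l K0 s1); rewrite [leRHS]mulrDr; apply: lerD.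
    by apply: IH => //; exact: ltnW.
  exact: le_trans (uA _ _ u01) hs.
have u01 : 0 <= (1 - t) / (1 - q) <= 1.
  rewrite ler_pdivlMr // mul0r ler_pdivrMr // mul1r; apply/andP; split; lra.
rewrite tower_dev_right -?/q ?(ltW tq) //.
apply: (le_trans (ler_normD _ _)).
apply: le_trans (ler_wpM2l K0 s2); rewrite [leRHS]mulrDr; apply: lerD.
  by apply: IH => //; case/andP: u01 => ? ?; apply/andP; split; lra.
exact: le_trans (uA _ _ u01) hs.
Qed.

(** In skewE each term is a binomial ratio tending to p ^ l (1 - p) ^ (N - l)
times N k/n - l; the missing prefactor n / (n - N) tends to 1. *)
Lemma skew_lim p : 0 < p < 1 ->
  skew z.1.-1 z.2.-1 * (z.1%:R / 'C(z.1, z.2)%:R) @[z --> ratio_nbhs p]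
    --> P_poly g N p.
Proof.
move=> p01; have nN : z.1%:R / (z.1 - N)%:R @[z --> ratio_nbhs p] --> (1 : R).
  have : (1 - N%:R * z.1%:R^-1)^-1 @[z --> ratio_nbhs p] --> (1 - N%:R * 0 :
    R)^-1.
    apply: cvgV; first by rewrite mulr0 subr0 oner_neq0.
    by apply: cvgB (cvg_cst _) _; apply: cvgM (cvg_cst _) (ratio_nbhs_inv p).
  rewrite mulr0 subr0 invr1; apply: cvg_trans; apply: near_eq_cvg.
  apply: filterS (ratio_nbhs_ge p N.+1) => -[n k] /= Nn.
  have n0 : n%:R != 0 :> R by rewrite pnatr_eq0 -lt0n (leq_ltn_trans _ Nn).
  have nN0 : n%:R - N%:R != 0 :> R by rewrite subr_eq0 eqr_nat gtn_eqF.
  rewrite natrB ?(ltnW Nn) //; field.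
  by rewrite n0 nN0.
have : z.1%:R / (z.1 - N)%:R * \sum_(0 <= l < N.+1) tower_total N l *
   ((bin_shift (z.1 - N) z.2 l)%:R / 'C(z.1, z.2)%:R
     * (N%:R * (z.2%:R / z.1%:R) - l%:R))
   @[z --> ratio_nbhs p] --> 1 * \sum_(0 <= l < N.+1) tower_total N l *
   (p ^+ l * (1 - p) ^+ (N - l) * (N%:R * p - l%:R)).
  apply: cvgM => //; rewrite big_mkord; under eq_fun do rewrite big_mkord.
  apply: cvg_big => [|l _]; first exact: add_continuous.
  apply: cvgM; first exact: cvg_cst.
  apply: cvgM; first by apply: bin_shift_ratio_lim => //; rewrite -ltnS.
  apply: cvgB; last exact: cvg_cst.
  by apply: cvgM; [exact: cvg_cst|exact: ratio_nbhs_ratio].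
rewrite mul1r; set L := \sum_(_ <= _ < _) _.
have -> : L = P_poly g N p.
  by apply: eq_bigr => l _; rewrite /tower_sum F_total !mulrA.
apply: cvg_trans; apply: near_eq_cvg.
apply: filterS2 (ratio_nbhs_ge p N.+1) (ratio_nbhs_lt p01).
move=> -[[|n] [|k]] //=; rewrite ltnS => Nn _.
have en : n = (n - N + N)%N by rewrite subnK.
have sk := skewE (n - N) k; rewrite -en in sk; rewrite sk subSn //.
set Sb := \sum_(_ <= _ < _) _; set Sk := \sum_(_ <= _ < _) _.
have -> : Sb = Sk * ('C(n.+1, k.+1)%:R)^-1.
  by rewrite mulr_suml; apply: eq_bigr => l _; ring.
ring.
Qed.

End TowerAsymptotics.

(** * Convergence of the rescaled curves *)

Section Convergence.
Context {R : realType}.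
Variables (N : nat) (g : R -> R).
Hypothesis mg : dyadic_measurable N g.
Implicit Types (n k : nat) (t : R) (z : nat * nat).

(** The deviation in the scale C(n, k) / n of the skews. *)
Definition tower_curve z t : R :=
  word_dev (tower_word g z.1 z.2) t * (z.1%:R / 'C(z.1, z.2)%:R).

Let bin_ratio_left n k : (k < n)%N ->
  n.+1%:R / 'C(n.+1, k.+1)%:R
    = n.+1%:R / n%:R * (k.+1%:R / n.+1%:R) * (n%:R / 'C(n, k)%:R) :> R.
Proof.
move=> kn; have n0 : n%:R != 0 :> R by rewrite pnatr_eq0 -lt0n (leq_ltn_trans _
  kn).
have C0 : 'C(n, k)%:R != 0 :> R by rewrite pnatr_eq0 -lt0n bin_gt0 ltnW.
have C1 : 'C(n.+1, k.+1)%:R != 0 :> R by rewrite pnatr_eq0 -lt0n bin_gt0 ltnS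
  ltnW.
have e : n.+1%:R * 'C(n, k)%:R = k.+1%:R * 'C(n.+1, k.+1)%:R :> R.
  by rewrite -!natrM -mul_bin_diag.
have n1 : n.+1%:R != 0 :> R by rewrite pnatr_eq0.
have k1 : k.+1%:R != 0 :> R by rewrite pnatr_eq0.
transitivity (k.+1%:R / 'C(n, k)%:R : R); last by field; rewrite C0 n0 nat1r n1.
by apply/eqP; rewrite eqr_div // e.
Qed.

Let bin_ratio_right n k : (k < n)%N ->
  n.+1%:R / 'C(n.+1, k.+1)%:R
    = n.+1%:R / n%:R * (1 - k.+1%:R / n.+1%:R) * (n%:R / 'C(n, k.+1)%:R) :> R.
Proof.
move=> kn; have n0 : n%:R != 0 :> R by rewrite pnatr_eq0 -lt0n (leq_ltn_trans _
  kn).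
have C0 : 'C(n, k.+1)%:R != 0 :> R by rewrite pnatr_eq0 -lt0n bin_gt0.
have C1 : 'C(n.+1, k.+1)%:R != 0 :> R by rewrite pnatr_eq0 -lt0n bin_gt0 ltnS
  ltnW.
have e : n.+1%:R * 'C(n, k.+1)%:R = (n.+1%:R - k.+1%:R) * 'C(n.+1, k.+1)%:R :>
  R.
  by rewrite -natrB ?ltnS 1?ltnW // -!natrM -mul_bin_down.
have n1 : n.+1%:R != 0 :> R by rewrite pnatr_eq0.
transitivity ((n.+1%:R - k.+1%:R) / 'C(n, k.+1)%:R : R).
  by apply/eqP; rewrite eqr_div // e.
by field; rewrite C0 nat1r n1 n0.
Qed.

Lemma tower_curve_left n k t (q := k.+1%:R / n.+1%:R : R) :
  (N <= n)%N -> (k < n)%N -> 0 <= t <= q ->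
  tower_curve (n.+1, k.+1) t = n.+1%:R / n%:R * q * tower_curve (n, k) (t / q)
    + t / q * (skew g n k * (n.+1%:R / 'C(n.+1, k.+1)%:R)).
Proof.
move=> Nn kn tq; rewrite /tower_curve /= (tower_dev_left mg) ?(ltnW kn) // -/q.
by rewrite mulrDl {1}bin_ratio_left // -/q; ring.
Qed.

Lemma tower_curve_right n k t (q := k.+1%:R / n.+1%:R : R) :
  (N <= n)%N -> (k < n)%N -> q <= t ->
  tower_curve (n.+1, k.+1) t
  = n.+1%:R / n%:R * (1 - q) * tower_curve (n, k.+1) (1 - (1 - t) / (1 - q))
    + (1 - t) / (1 - q) * (skew g n k * (n.+1%:R / 'C(n.+1, k.+1)%:R)).
Proof.
move=> Nn kn tq; rewrite /tower_curve /= (tower_dev_right mg) // -/q.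
by rewrite mulrDl {1}bin_ratio_right // -/q; ring.
Qed.

Variables (p : R) (M : R -> R).
Hypotheses (p01 : 0 < p < 1) (Ms : supp01 M) (Mu : unif_continuous M)
  (Mfix : forall t, M t = curve_op p M t).

Let p0 : 0 < p. Proof. by case/andP: p01. Qed.
Let q0 : 0 < 1 - p. Proof. by case/andP: p01 => _; rewrite subr_gt0. Qed.

Lemma fixpoint_max : exists2 t0, 0 <= t0 <= 1 & forall t, `|M t| <= `|M t0|.
Proof.
have Mc : {within `[0, 1], continuous (fun t => `|M t|)}.
  apply: continuous_subspaceT => t; apply: cvg_norm.
  exact: (unif_continuous_real Mu).
have [t0] := EVT_max ler01 Mc; rewrite in_itv /= => t01 tmax.
exists t0 => // t; have [h|h] := boolP (0 < t < 1).
  by apply: tmax; rewrite in_itv /=; case/andP: h => ? ?; rewrite !ltW.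
by rewrite (Ms h) normr0.
Qed.

Lemma fixpoint_at : M p = 1.
Proof.
rewrite Mfix curve_op_left // ?lexx ?(ltW p0) // divff ?gt_eqF //.
by rewrite Ms ?mulr0 ?add0r // ltxx andbF.
Qed.

(** n C(n, k)^-1 dev_bound n k is about 1 / (x (1 - x)) with x = k/n. *)
Lemma tower_curve_bounded : exists B : R,
  \forall z \near ratio_nbhs p, forall t, 0 <= t <= 1 -> `|tower_curve z t| <=
    B.
Proof.
have [K Kdev] := tower_dev_bound mg.
exists (K * (8 / (p * (1 - p)))).
near=> z; have zN : (N <= z.1)%N by near: z; exact: ratio_nbhs_ge.
have /andP[z0 zz] : (0 < z.2 < z.1)%N by near: z; exact: ratio_nbhs_lt.
have zp : p / 2 < z.2%:R / z.1%:R.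
  by near: z; apply: (cvgr_gt _ (ratio_nbhs_ratio (p := p))); have := p0; lra.
have zp' : z.2%:R / z.1%:R < (1 + p) / 2.
  by near: z; apply: (cvgr_lt _ (ratio_nbhs_ratio (p := p))); have := q0; lra.
move=> t t01; rewrite /tower_curve normrM.
have C0 : 0 < 'C(z.1, z.2)%:R :> R by rewrite ltr0n bin_gt0 ltnW.
have n0 : 0 < z.1%:R :> R by rewrite ltr0n (ltn_trans z0).
rewrite [X in _ * X]ger0_norm; last by rewrite divr_ge0.
apply: le_trans (ler_wpM2r _ (Kdev _ _ _ zN (ltnW zz) t01)) _.
  by rewrite divr_ge0.
have d0 : 0 < dev_bound (R := R) z.1 z.2.
  by rewrite /dev_bound divr_gt0 ?mulr_gt0 ?ltr0n // bin_gt0 ltnW.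
have K0 : 0 <= K.
  rewrite -(pmulr_lge0 K d0); apply: le_trans (Kdev _ _ _ zN (ltnW zz) t01).
  exact: normr_ge0.
rewrite -mulrA ler_wpM2l // /dev_bound.
set n : R := z.1%:R; set k : R := z.2%:R; set c : R := 'C(_, _)%:R.
have k1 : 1 <= k by rewrite ler1n.
have kn : k + 1 <= n by rewrite natr1 ler_nat.
have -> : z.1.+1%:R = n + 1 :> R by rewrite natr1.
have -> : z.2.+1%:R = k + 1 :> R by rewrite natr1.
have -> : (z.1 - z.2).+1%:R = n - k + 1 :> R by rewrite -natr1 natrB // ltnW.
have -> : c * (n + 1) / ((k + 1) * (n - k + 1)) * (n / c)
    = (n + 1) * n / ((k + 1) * (n - k + 1)).
  by field; rewrite !gt_eqF //; lra.
have h1 : p / 2 * n <= k by rewrite -ler_pdivlMr // ltW.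
have h2 : (1 - p) / 2 * n <= n - k.
  have : k <= (1 + p) / 2 * n by rewrite -ler_pdivrMr // ltW.
  lra.
have pq0 : 0 < p * (1 - p) by rewrite mulr_gt0.
rewrite ler_pdivrMr; last by rewrite mulr_gt0 //; lra.
rewrite mulrAC ler_pdivlMr //.
have h3 : (p / 2 * n) * ((1 - p) / 2 * n) <= (k + 1) * (n - k + 1).
  apply: ler_pM; [| |lra|lra]; rewrite mulr_ge0 ?divr_ge0 //; exact: ltW.
have h4 : (n + 1) * n * (p * (1 - p)) <= (2 * n) * n * (p * (1 - p)).
  rewrite ler_pM2r // ler_pM2r //; lra.
apply: (le_trans h4); lra.
Unshelve. all: by end_near. Qed.

Let P := P_poly g N p.

(** The deterministic part of the contraction step.  The factor c = n / (n - 1)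
comes from the change of scale between two stages; a is the height of the
tent, q the cutting point, and the error has three sources: c differs from 1,
a from P, and q from p. *)
Lemma tower_curve_step_at z (r b e B c q a : R) :
  c = z.1%:R / z.1.-1%:R -> q = z.2%:R / z.1%:R ->
  a = skew g z.1.-1 z.2.-1 * (z.1%:R / 'C(z.1, z.2)%:R) ->
  (N < z.1)%N -> (0 < z.2 < z.1)%N -> 0 <= b -> (forall t, `|M t| <= B) ->
  (forall t, 0 <= t <= 1 -> `|tower_curve (z.1.-1, z.2.-1) t - P * M t| <= b) ->
  (forall t, 0 <= t <= 1 -> `|tower_curve (z.1.-1, z.2) t - P * M t| <= b) ->
  `|a - P| <= e / 3 ->
  (forall t, 0 <= t <= 1 -> `|curve_op q M t - M t| * (3 * (`|P| + 1)) <= e) ->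
  c * q <= r -> c * (1 - q) <= r -> (c - 1) * (`|P| * B) <= e / 3 ->
  forall t, 0 <= t <= 1 -> `|tower_curve z t - P * M t| <= r * b + e.
Proof.
move=> ec eq ea; case: z ec eq ea => [[|n] [|k]] //= ec eq ea.
rewrite !ltnS => Nn kn b0 MB cl cr aP SM cqr cqr' cB t t01.
have n0 : 0 < n%:R :> R by rewrite ltr0n (leq_ltn_trans _ kn).
have q01 : 0 < q < 1.
  by rewrite eq divr_gt0 ?ltr0n //= ltr_pdivrMr ?ltr0n // mul1r ltr_nat ltnS.
have /andP[qp q1] := q01; have q1' : 0 < 1 - q by lra.
have c1 : 1 <= c by rewrite ec ler_pdivlMr // mul1r ler_nat.
(* Both halves of the curve reduce to this estimate, with s the length of the
   half and u the height of the unit tent at t. *)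
have key (s u x y : R) : 0 <= s <= 1 -> 0 <= u <= 1 -> c * s <= r ->
    `|x - P * y| <= b -> `|y| <= B ->
    `|s * y + u - M t| * (3 * (`|P| + 1)) <= e ->
    `|c * s * x + u * a - P * M t| <= r * b + e.
  move=> /andP[s0 s1] /andP[u0 u1] csr xb yB hS.
  (* In order: contracted error, change of scale, error on the tent height,
     error on the cutting point. *)
  have -> : c * s * x + u * a - P * M t
     = c * s * (x - P * y) + s * ((c - 1) * (P * y)) + u * (a - P)
       + P * (s * y + u - M t) by ring.
  have cs0 : 0 <= c * s by rewrite mulr_ge0 //; lra.
  have h1 : `|c * s * (x - P * y)| <= r * b.
    by rewrite normrM (ger0_norm cs0) ler_pM.
  have h2 : `|s * ((c - 1) * (P * y))| <= e / 3.
    rewrite normrM (ger0_norm s0); apply: le_trans (_ : 1 * (e / 3) <= _);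
      last by rewrite mul1r.
    apply: ler_pM => //; apply: le_trans cB.
    have c10 : 0 <= c - 1 by lra.
    by rewrite !normrM (ger0_norm c10) ler_wpM2l // ler_wpM2l.
  have h3 : `|u * (a - P)| <= e / 3.
    rewrite normrM (ger0_norm u0); apply: le_trans (_ : 1 * (e / 3) <= _);
      last by rewrite mul1r.
    exact: ler_pM.
  have h4 : `|P * (s * y + u - M t)| <= e / 3.
    rewrite normrM; move: hS; set d := `|_ + _ - _|.
    have : 0 <= d by exact: normr_ge0.
    lra.
  apply: (le_trans (ler_normD _ _)).
  have := ler_normD (c * s * (x - P * y) + s * ((c - 1) * (P * y))) (u * (a -
    P)).
  have := ler_normD (c * s * (x - P * y)) (s * ((c - 1) * (P * y))).
  lra.
have := SM t t01; case/andP: t01 => t0 t1; have [tq|tq] := leP t q.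
  have u01 : 0 <= t / q <= 1.
    by rewrite divr_ge0 ?(ltW qp) //= ler_pdivrMr // mul1r.
  rewrite tower_curve_left -?eq ?t0 // -ec -ea curve_op_left ?t0 //.
  by apply: key => //; [rewrite !ltW|exact: cl].
have v01 : 0 <= (1 - t) / (1 - q) <= 1.
  rewrite ler_pdivlMr // mul0r ler_pdivrMr // mul1r; apply/andP; split; lra.
have w01 : 0 <= 1 - (1 - t) / (1 - q) <= 1 by case/andP: v01 => ? ?;
  apply/andP; split; lra.
rewrite tower_curve_right -?eq ?(ltW tq) // -ec -ea curve_op_right ?(ltW tq) //.
by apply: key => //; [apply/andP; split; lra|exact: cr].
Qed.

Lemma tower_curve_step (r b : R) : p < r -> 1 - p < r -> 0 <= b ->
  (\forall z \near ratio_nbhs p, forall t, 0 <= t <= 1 ->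
     `|tower_curve z t - P * M t| <= b) ->
  forall e, 0 < e -> \forall z \near ratio_nbhs p, forall t, 0 <= t <= 1 ->
     `|tower_curve z t - P * M t| <= r * b + e.
Proof.
move=> pr qr b0 hb e e0; have [predl predr] := ratio_nbhs_pred p01.
have hl := predl _ hb; have hr := predr _ hb.
have [t0 _ Mt0] := fixpoint_max.
pose B := `|M t0|; have B0 : 0 <= B by exact: normr_ge0.
pose a z := skew g z.1.-1 z.2.-1 * (z.1%:R / 'C(z.1, z.2)%:R).
have al : \forall z \near ratio_nbhs p, `|a z - P| <= e / 3.
  have e3 : 0 < e / 3 by lra.
  have /cvgrPdist_le /(_ _ e3) := skew_lim mg p01.
  by apply: filterS => z; rewrite distrC.
have Sl : \forall z \near ratio_nbhs p, forall t, 0 <= t <= 1 ->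
    `|curve_op (z.2%:R / z.1%:R) M t - M t| * (3 * (`|P| + 1)) <= e.
  have P1 : 0 < `|P| + 1 by have := normr_ge0 P; lra.
  have e3 : 0 < e / (3 * (`|P| + 1)) by rewrite divr_gt0 ?mulr_gt0.
  have MB : exists B, forall x, `|M x| <= B by exists B.
  have h : \forall z \near ratio_nbhs p, forall t, 0 <= t <= 1 ->
      `|curve_op (z.2%:R / z.1%:R) M t - curve_op p M t| <= e / (3 * (`|P| +
        1)).
    exact: ratio_nbhs_ratio (curve_op_param p01 Mu MB e3).
  apply: filterS h => z h t /h.
  by rewrite -Mfix ler_pdivlMr // mulr_gt0.
have cl : z.1%:R / z.1.-1%:R @[z --> ratio_nbhs p] --> (1 : R).
  have : (1 - z.1%:R^-1)^-1 @[z --> ratio_nbhs p] --> (1 - 0 : R)^-1.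
    apply: cvgV; first by rewrite subr0 oner_neq0.
    exact: cvgB (cvg_cst _) (ratio_nbhs_inv p).
  rewrite subr0 invr1; apply: cvg_trans; apply: near_eq_cvg.
  apply: filterS (ratio_nbhs_ge p 2) => -[[|[|n]] k] //= _.
  by field; rewrite nat1r -natrD !pnatr_eq0.
have clq : \forall z \near ratio_nbhs p,
    z.1%:R / z.1.-1%:R * (z.2%:R / z.1%:R) <= r.
  have := cvgM cl (ratio_nbhs_ratio (p := p)); rewrite mul1r.
  by move=> /(_ (ratio_nbhs_filter p)) /cvgr_le; apply.
have clq' : \forall z \near ratio_nbhs p,
    z.1%:R / z.1.-1%:R * (1 - z.2%:R / z.1%:R) <= r.
  have h : 1 - z.2%:R / z.1%:R @[z --> ratio_nbhs p] --> 1 - p.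
    exact: cvgB (cvg_cst _) (ratio_nbhs_ratio (p := p)).
  have := cvgM cl h; rewrite mul1r.
  by move=> /(_ (ratio_nbhs_filter p)) /cvgr_le; apply.
have clB : \forall z \near ratio_nbhs p,
    (z.1%:R / z.1.-1%:R - 1) * (`|P| * B) <= e / 3.
  have h : (z.1%:R / z.1.-1%:R - 1) * (`|P| * B) @[z --> ratio_nbhs p]
      --> (1 - 1) * (`|P| * B).
    by apply: cvgM (cvg_cst _); apply: cvgB cl (cvg_cst _).
  by apply: (cvgr_le _ h); rewrite subrr mul0r; lra.
near=> z; apply: (@tower_curve_step_at z r b e B _ _ (a z)) => //.
- by near: z; exact: ratio_nbhs_ge.
- by near: z; exact: ratio_nbhs_lt.
- by near: z.
- by near: z.
- by near: z.
- by near: z.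
- by near: z.
- by near: z.
- by near: z.
Unshelve. all: by end_near. Qed.

(** Iterating the contraction from the a priori bound. *)
Lemma tower_curve_lim (e : R) : 0 < e ->
  \forall z \near ratio_nbhs p, forall t, 0 <= t <= 1 ->
    `|tower_curve z t - P * M t| <= e.
Proof.
move=> e0; pose r := (1 + Num.max p (1 - p)) / 2.
(* r leaves room for the factor n / (n - 1). *)
have m1 : Num.max p (1 - p) < 1.
  by rewrite gt_max; case/andP: p01 => ? ?; apply/andP; split; lra.
have pm : p <= Num.max p (1 - p) by rewrite le_max lexx.
have qm : 1 - p <= Num.max p (1 - p) by rewrite le_max lexx orbT.
have r01 : 0 < r < 1 by rewrite /r; apply/andP; split; have := p0; lra.
have /andP[r0 r1] := r01.
have pr : p < r by rewrite /r; lra.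
have qr : 1 - p < r by rewrite /r; lra.
have [B hB] := tower_curve_bounded; have [t0 _ Mt0] := fixpoint_max.
pose b := `|B| + `|P| * `|M t0|.
have b0 : 0 <= b by rewrite addr_ge0 // mulr_ge0.
(* e / 2 is the fixed point of x |-> r x + (1 - r) e / 2. *)
have H j : \forall z \near ratio_nbhs p, forall t, 0 <= t <= 1 ->
    `|tower_curve z t - P * M t| <= r ^+ j * b + e / 2.
  elim: j => [|j IH].
    apply: filterS hB => z zB t t01; apply: (le_trans (ler_normB _ _)).
    have h1 := le_trans (zB t t01) (ler_norm B).
    have h2 : `|P * M t| <= `|P| * `|M t0| by rewrite normrM ler_wpM2l.
    by rewrite expr0 mul1r /b; lra.
  have re : 0 < (1 - r) * (e / 2) by rewrite mulr_gt0; lra.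
  have rb : 0 <= r ^+ j * b + e / 2.
    by rewrite addr_ge0 ?mulr_ge0 ?exprn_ge0 //; lra.
  apply: filterS (tower_curve_step pr qr rb IH re) => z zb t t01.
  by apply: le_trans (zb t t01) _; rewrite exprS; lra.
have eb : 0 < e / (2 * (b + 1)) by rewrite divr_gt0 // mulr_gt0 //; lra.
have [j rj] := expr_lt_eps r01 eb.
apply: filterS (H j) => z zb t t01; apply: le_trans (zb t t01) _.
move: rj; rewrite ltr_pdivlMr; last by rewrite mulr_gt0 //; lra.
have : 0 <= r ^+ j by rewrite exprn_ge0 // ltW.
lra.
Qed.

End Convergence.

(** * Renormalization *)

Section Renormalization.
Context {R : realType}.
Implicit Types (g : R -> R) (n k : nat) (t L e : R).

Lemma F_dev_curve g n k t : 0 <= t <= 1 ->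
  tower_curve g (n, k) t = F_dev g n k t * (n%:R / 'C(n, k)%:R).
Proof. by move=> t01; rewrite F_dev_word. Qed.

(** L is the maximum of the modulus of the limit curve: uniform closeness of
curves passes to the maxima of their moduli. *)
Lemma renorm_close g n k L e : (0 < k < n)%N -> e < L ->
  (forall t, 0 <= t <= 1 -> `|tower_curve g (n, k) t| <= L + e) ->
  (exists2 t, 0 <= t <= 1 & L - e <= `|tower_curve g (n, k) t|) ->
  `|renorm g n k * (n%:R / 'C(n, k)%:R) - L| <= e.
Proof.
move=> kn eL up [t0 t01 lo]; have /andP[k0 kn'] := kn.
set s := n%:R / 'C(n, k)%:R.
have s0 : 0 < s.
  by rewrite divr_gt0 ?ltr0n ?bin_gt0 ?(ltnW kn') // (ltn_trans k0).
have cE t : 0 <= t <= 1 -> `|tower_curve g (n, k) t| = `|F_dev g n k t| * s.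
  by move=> h; rewrite F_dev_curve // normrM (gtr0_norm s0).
pose E := [set `|F_dev g n k t| | t in `[0, 1]].
have Eub : ubound E ((L + e) / s).
  move=> _ [t /= + <-]; rewrite in_itv /= => h.
  by rewrite ler_pdivlMr // -cE // up.
have h1 : max_dev g n k <= (L + e) / s.
  apply: ge_sup; last exact: Eub.
  by exists `|F_dev g n k t0|; exists t0 => //=; rewrite in_itv.
have h2 : (L - e) / s <= max_dev g n k.
  apply: le_trans (_ : `|F_dev g n k t0| <= _).
    by rewrite ler_pdivrMr // -cE.
  apply: ub_le_sup; first by exists ((L + e) / s).
  by exists t0 => //=; rewrite in_itv.
have h3 : 0 < max_dev g n k by apply: lt_le_trans h2;
  rewrite divr_gt0 // subr_gt0.
move: h1 h2; rewrite /renorm gt_eqF // ler_pdivlMr // ler_pdivrMr // => h1 h2.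
by rewrite ler_norml; apply/andP; split; lra.
Qed.

End Renormalization.

Theorem theorem2p5 (R : realType) (N0 : nat) (g : R -> R) (p : R)
    (k : nat -> nat) :
  (1 <= N0)%N ->
  dyadic_measurable N0 g ->
  0 < p < 1 ->
  P_poly g N0 p != 0 ->
  (forall n, (k n <= n)%N) ->
  (fun n => (k n)%:R / n%:R : R) @ \oo --> p ->
  (fun n => Linfty_norm (fun t => phi g n (k n) t
     - Num.sg (P_poly g N0 p) * (Mcurve p t / fine (Linfty_norm (Mcurve p)))))
    @ \oo --> 0%E
  /\ of_order (fun n => renorm g n (k n))
       (fun n => n%:R^-1 * 'C(n, k n)%:R).
Proof.
move=> _ mg p01 P0 kn klim.
have [M [Ms Mu Mfix]] := curve_op_fixpoint p01.
have [t0 t01 tmax] := fixpoint_max Ms Mu.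
set P := P_poly g N0 p in P0 *; set nu := `|M t0|.
have nu0 : 0 < nu.
  by apply: lt_le_trans (tmax p); rewrite (fixpoint_at p01 Ms Mfix) normr1.
have McE := McurveE p01 Ms Mu Mfix.
have normM : fine (Linfty_norm (Mcurve p)) = nu.
  suff -> : Linfty_norm (Mcurve p) = nu%:E by [].
  apply/eqP; rewrite eq_le; apply/andP; split.
    by apply: Linfty_norm_le => [|t /McE ->]; [exact: ltW|exact: tmax].
  have Mp := Mcurve_patch p01 Ms Mu Mfix.
  have := @Linfty_norm_cont R (Mcurve p) t0; rewrite Mp; apply.
  exact: unif_continuous_real.
have PP : 0 < `|P| by rewrite normr_gt0.
pose L := `|P| * nu; have L0 : 0 < L by rewrite mulr_gt0.
have sgE : Num.sg P = P / `|P|.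
  by rewrite {2}[P]numEsg mulfK // normr_eq0.
have kPhi : (fun n => (n, k n)) @ \oo --> ratio_nbhs p.
  apply: (@cvg_ratio_nbhs R nat \oo _ p) => [m|]; last exact: klim.
  exact: nbhs_infty_ge.
have PM t : `|P * M t| <= L by rewrite normrM ler_wpM2l.
have main e : 0 < e -> \forall n \near \oo, (0 < k n < n)%N /\
    forall t, 0 <= t <= 1 -> `|tower_curve g (n, k n) t - P * M t| <= e.
  move=> e0; have h1 : \forall n \near \oo, (0 < k n < n)%N.
    exact: kPhi (ratio_nbhs_lt p01).
  have h2 : \forall n \near \oo, forall t, 0 <= t <= 1 ->
      `|tower_curve g (n, k n) t - P * M t| <= e.
    exact: kPhi (tower_curve_lim mg p01 Ms Mu Mfix e0).
  by apply: filterS2 h1 h2 => n ? ?; split.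
have close e n : e < L -> (0 < k n < n)%N ->
    (forall t, 0 <= t <= 1 -> `|tower_curve g (n, k n) t - P * M t| <= e) ->
    `|renorm g n (k n) * (n%:R / 'C(n, k n)%:R) - L| <= e.
  move=> eL k0 ce; apply: renorm_close => //.
    move=> t ht; have := ce t ht; have := PM t.
    have := ler_normD (tower_curve g (n, k n) t - P * M t) (P * M t).
    rewrite subrK; lra.
  exists t0 => //; have := ce t0 t01.
  have := ler_normD (P * M t0 - tower_curve g (n, k n) t0) (tower_curve g (n, k
    n) t0).
  rewrite subrK distrC normrM -/nu -/L; lra.
split; last first.
  exists (L / 2), (2 * L); split; [lra|lra|].
  have L2 : 0 < L / 2 by lra.
  (* With error L / 2 the rescaled renormalization lies in [L / 2, 3 L / 2]. *)
  apply: filterS (main _ L2) => n [k0 ce].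
  have L2L : L / 2 < L by lra.
  have := close _ _ L2L k0 ce; rewrite ler_norml => /andP[h1 h2].
  have /andP[kp kn'] := k0.
  have n0 : 0 < n%:R :> R by rewrite ltr0n (ltn_trans kp).
  have C0 : 0 < 'C(n, k n)%:R :> R by rewrite ltr0n bin_gt0 ltnW.
  set s := n%:R / _ in h1 h2; set v := _^-1 * _.
  have sv : v = s^-1 by rewrite /v /s invf_div mulrC.
  have s0 : 0 < s by rewrite divr_gt0.
  have r0 : 0 <= renorm g n (k n).
    by rewrite -(pmulr_lge0 _ s0); lra.
  rewrite ger0_norm // sv ler_pdivrMr // ler_pdivlMr //.
  by apply/andP; split; lra.
apply/fine_cvgP.
have small e : 0 < e -> \forall n \near \oo,
   (Linfty_norm (fun t => (phi g n (k n) t - Num.sg P *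
      (Mcurve p t / fine (Linfty_norm (Mcurve p))))%R) <= e%:E)%E.
  move=> e0; pose d := Num.min (L / 2) (e * L / 4).
  have d0 : 0 < d by rewrite lt_min !divr_gt0 // mulr_gt0.
  have dL : d <= L / 2 by rewrite ge_min lexx.
  have de : d <= e * L / 4 by rewrite ge_min lexx orbT.
  apply: filterS (main _ d0) => n [k0 ce].
  apply: Linfty_norm_le; first exact: ltW.
  move=> t ht; rewrite normM sgE McE //.
  have hr : `|renorm g n (k n) * (n%:R / 'C(n, k n)%:R) - L| <= d.
    by apply: close => //; lra.
  have /andP[kp kn'] := k0.
  have n0 : 0 < n%:R :> R by rewrite ltr0n (ltn_trans kp).
  have C0 : 0 < 'C(n, k n)%:R :> R by rewrite ltr0n bin_gt0 ltnW.
  have s0 : 0 < n%:R / 'C(n, k n)%:R :> R by rewrite divr_gt0.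
  have := ce t ht; have := PM t; rewrite F_dev_curve // /phi.
  move: hr s0; set s := n%:R / _; set f := F_dev _ _ _ _;
    set rn := renorm _ _ _.
  set m := P * M t; set rho := rn * s => hr s0 hm hf.
  have rho2 : L / 2 <= rho by move: hr; rewrite ler_norml => /andP[? _]; lra.
  have rho0 : 0 < rho by lra.
  have rn0 : 0 < rn by rewrite -(pmulr_lgt0 _ s0).
  (* f s is close to m and rho to L, so f s / rho is close to m / L. *)
  have -> : f / rn - P / `|P| * (M t / nu)
      = ((f * s - m) * L + m * (L - rho)) / (rho * L).
    rewrite /m /rho /L; field.
    by rewrite !gt_eqF.
  have rhoL : 0 < rho * L by exact: mulr_gt0.
  rewrite normrM normfV (gtr0_norm rhoL) ler_pdivrMr //.
  apply: (le_trans (ler_normD _ _));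
    rewrite (normrM _ L) (normrM m) (gtr0_norm L0).
  have h1 : `|f * s - m| * L <= d * L by rewrite ler_pM2r.
  have h2 : `|m| * `|L - rho| <= L * d by rewrite ler_pM // distrC.
  have h3 : e * (L / 2 * L) <= e * (rho * L) by rewrite ler_pM2l // ler_pM2r.
  have h4 : d * L <= e * L / 4 * L by rewrite ler_pM2r.
  lra.
split.
  apply: filterS (small 1 ltr01) => n h.
  by rewrite ge0_fin_numE ?Linfty_norm_ge0 // (le_lt_trans h) // ltry.
apply/cvgrPdist_le => e e0; apply: filterS (small e e0) => n h /=.
have x0 := Linfty_norm_ge0 (fun t => phi g n (k n) t - Num.sg P *
      (Mcurve p t / fine (Linfty_norm (Mcurve p)))).
rewrite sub0r normrN; move: x0 h; case: (Linfty_norm _) => // x.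
by rewrite !lee_fin /= => x0; rewrite ger0_norm.
Qed.
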